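(* Let $\mathcal{D}$ be any distribution over $\{\pm1\}^n\times\{\pm1\}$ whose marginal on the features $\{\pm1\}^n$ is uniform, and let $\mathcal{H}=\{x\mapsto\mathrm{sign}(w^\top x-\theta):(w,\theta)\in\mathbb{R}^{n+1}\}$ be the class of halfspaces. For every $\varepsilon,\delta\in(0,1)$ there exists some $d$ such that running the Boosting Algorithm (described in the context) with empirical risk minimization over parities of degree at most $d$ as the weak learner produces, with probability at least $1-\delta$, a classifier $\overline{h}$ such that $$l_{\mathcal{D}}(\overline{h})\le\min_{h\in\mathcal{H}}l_{\mathcal{D}}(h)+\varepsilon,$$ while using $\mathcal{O}(\varepsilon^{-7}n^{60\varepsilon^{-4}})$ samples in $n^{\mathrm{poly}(1/\varepsilon)}$ time. Here $\mathcal{O}$ suppresses absolute constants and polylogarithmic factors.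
   Context: Loss and correlation. $l_{\mathcal{D}}(h)=\Pr_{(x,y)\sim\mathcal{D}}[h(x)\ne y]$. $\mathrm{corr}_{\mathcal{D}}(h)=\mathbb{E}_{(x,y)\sim\mathcal{D}}[yh(x)]$; for a finite dataset $\widehat D$, $\mathrm{corr}_{\widehat D}(h)$ is the empirical average of $yh(x)$ over $\widehat D$. Parities. For $A\subseteq[n]$, $\chi_A(x)=\prod_{i\in A}x_i$. The parities of degree at most $d$ (with signs) form $\mathcal{B}_{n,d}=\{\pm\chi_A:|A|\le d\}$. The weak learner $\mathcal{W}$ is ERM over $\mathcal{B}_{n,d}$: given a dataset it returns the member of $\mathcal{B}_{n,d}$ with smallest empirical 0-1 loss. It is used with edge parameter $\gamma=n^{-d}$. Potential. $\phi(z)=2-z$ for $z\le0$ and $\phi(z)=(z+2)e^{-z}$ for $z>0$. It is $C^2$. Sign. $\mathrm{sign}(f)(x)=+1$ if $f(x)\ge0$ and $-1$ if $f(x)<0$. Boosting Algorithm. Inputs: sampling oracle for $\mathcal{D}$, weak learner $\mathcal{W}$ with edge $\gamma$, step size $\eta$, mixing parameter $\sigma$, number of iterations $T$, per-iteration sample size $S$, resampling parameter $m$, branching tolerance $\tau$, post-selection sample size $S_0$, potential $\phi$ (the numerical parameters are to be suitably chosen). Initialize $H_1=\mathbf{0}$. For $t=1,\dots,T$: (1) Draw $S$ IID examples from $\mathcal{D}$ to form $\widehat D_t$. (2) Define a sampling distribution $\mathcal{D}_t$. If $t=1$, $\mathcal{D}_1$ is uniform on $\widehat D_1$. If $t>1$,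 a sample from $\mathcal{D}_t$ is generated as follows: with probability $1-\sigma$ return a sample from $\mathcal{D}_{t-1}$; with probability $\sigma$, draw $\eta'\sim\mathrm{Unif}[0,\eta]$ and $(x,y)$ uniformly from $\widehat D_t$, and return $(x,\hat y)$ where $\hat y=+1$ with probability $p_t(x,y,\eta')$ and $\hat y=-1$ with probability $1-p_t(x,y,\eta')$, with $$p_t(x,y,\eta')=\frac12-\frac{\sigma\,\phi'(yH_{t-1}(x))\,y+\eta\,\phi''\big(y(H_{t-1}(x)+\eta'h_{t-1}(x))\big)\,h_{t-1}(x)}{2(\eta+\sigma)}.$$ (3) Draw $m$ samples from $\mathcal{D}_t$ to form $\widehat D'_t$ (this uses no new examples from $\mathcal{D}$), and call the weak learner to get $W_t=\mathcal{W}(\widehat D'_t)$. (4) If $\mathrm{corr}_{\widehat D'_t}(W_t)>\tau$ set $h_t=W_t/\gamma$; otherwise set $h_t=-\mathrm{sign}(H_t)$. (5) Set $H_{t+1}=H_t+\eta h_t$. Finally draw $S_0$ IID examples from $\mathcal{D}$ to form $\widehat D_0$ and output $\overline h\in\arg\max_{h\in\{\mathrm{sign}(H_t):t\in[T]\}}\sum_{(x,y)\in\widehat D_0}yh(x)$. *)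

(* Defs.v *)
(* MathComp + MathComp-Analysis. *)
From HB Require Import structures.
From mathcomp Require Import all_boot all_order all_algebra.
From mathcomp Require Import all_classical all_reals all_analysis.

Set Implicit Arguments.
Unset Strict Implicit.
Unset Printing Implicit Defensive.

Import Order.TTheory GRing.Theory Num.Theory.
Import numFieldNormedType.Exports.

Local Open Scope classical_set_scope.
Local Open Scope ring_scope.

(* Signs are booleans, with [true] for +1 and [false] for -1. *)
Definition cube (n : nat) := {ffun 'I_n -> bool}.
Definition example (n : nat) := (cube n * bool)%type.
Definition classifier (n : nat) := cube n -> bool.

Definition pm {R : realType} (b : bool) : R := if b then 1 else -1.

Record distr (R : realType) (n : nat) := Distr {
  mass :> example n -> R;
  mass_ge0 : forall z, 0 <= mass z;
  mass_sum1 : \sum_z mass z = 1 }.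

Definition uniform_marginal (R : realType) (n : nat) (D : distr R n) : Prop :=
  forall x : cube n, \sum_(y : bool) D (x, y) = (2 ^+ n)^-1.

Definition loss (R : realType) (n : nat) (D : distr R n) (h : classifier n) : R :=
  \sum_(z | h z.1 != z.2) D z.

Definition halfspace (R : realType) (n : nat) (w : 'rV[R]_n) (theta : R)
  : classifier n :=
  fun x => 0 <= \sum_i w 0 i * pm (x i) - theta.

(* Only finitely many classifiers exist, so this infimum is a minimum. *)
Definition opt_halfspace (R : realType) (n : nat) (D : distr R n) : R :=
  inf [set l | exists (w : 'rV[R]_n) (theta : R), l = loss D (halfspace w theta)].

(* Randomized computations with real-number arithmetic.  Every node other than
   [Ret] takes one unit of time; [Tick] stands for a bounded number of
   arithmetic operations, comparisons, exponentials or memory accesses. *)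
Inductive prog (R : realType) (n : nat) (A : Type) : Type :=
| Ret of A
| Tick of prog R n A
| Example of (example n -> prog R n A)   (* query to the sampling oracle *)
| Coin of R & (bool -> prog R n A)       (* [true] with the given probability *)
| Unif of R & (R -> prog R n A)          (* uniform on [0, a] *)
| Pick (N : nat) of ('I_N -> prog R n A) (* uniform on 'I_N *).

Arguments Ret {R n A}.
Arguments Tick {R n A}.
Arguments Example {R n A}.
Arguments Coin {R n A}.
Arguments Unif {R n A}.
Arguments Pick {R n A N}.

Fixpoint bind (R : realType) (n : nat) (A B : Type) (P : prog R n A)
    (f : A -> prog R n B) : prog R n B :=
  match P with
  | Ret a => f a
  | Tick P' => Tick (bind P' f)
  | Example k => Example (fun z => bind (k z) f)
  | Coin p k => Coin p (fun b => bind (k b) f)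
  | Unif a k => Unif a (fun u => bind (k u) f)
  | Pick N k => Pick (fun i => bind (k i) f)
  end.

Notation "'let!' x := P 'in' Q" := (bind P (fun x => Q))
  (at level 200, x name, P at level 200, Q at level 200, right associativity).

Fixpoint expect (R : realType) (n : nat) (A : Type) (D : distr R n)
    (f : A -> R) (P : prog R n A) : R :=
  match P with
  | Ret a => f a
  | Tick P' => expect D f P'
  | Example k => \sum_z D z * expect D f (k z)
  | Coin p k => p * expect D f (k true) + (1 - p) * expect D f (k false)
  | Unif a k =>
      a^-1 * \int[lebesgue_measure]_(u in `[0, a]) expect D f (k u)
  | Pick N k => N%:R^-1 * \sum_(i < N) expect D f (k i)
  end.

Definition prob (R : realType) (n : nat) (A : Type) (D : distr R n)
    (E : A -> bool) (P : prog R n A) : R :=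
  expect D (fun a => (E a)%:R) P.

(* On every execution path all random choices are meaningful (coin biases lie
   in [0, 1], intervals and index sets are nonempty), at most [q] examples are
   drawn and at most [t] units of time are used. *)
Fixpoint runs_within (R : realType) (n : nat) (A : Type) (P : prog R n A)
    (q t : nat) {struct P} : Prop :=
  match P, t with
  | Ret _, _ => True
  | _, 0%N => False
  | Tick P', t'.+1 => runs_within P' q t'
  | Example k, t'.+1 =>
      if q is q'.+1 then forall z, runs_within (k z) q' t' else False
  | Coin p k, t'.+1 => 0 <= p <= 1 /\ forall b, runs_within (k b) q t'
  | Unif a k, t'.+1 =>
      0 < a /\ forall u, 0 <= u <= a -> runs_within (k u) q t'
  | Pick N k, t'.+1 => (0 < N)%N /\ forall i, runs_within (k i) q t'
  end.

Definition step {R : realType} {n : nat} {A : Type} (a : A) : prog R n A :=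
  Tick (Ret a).

(* Fetching a fresh example costs [n] additional units. *)
Definition draw {R : realType} {n : nat} : prog R n (example n) :=
  iter n Tick (Example Ret).

Definition pick {R : realType} {n : nat} {A : Type} (s : seq A) : prog R n A :=
  Pick (fun i => Ret (tnth (in_tuple s) i)).

Fixpoint foldM (R : realType) (n : nat) (I A : Type) (f : A -> I -> prog R n A)
    (a : A) (s : seq I) : prog R n A :=
  if s is i :: s' then Tick (let! a' := f a i in foldM f a' s') else Ret a.

Fixpoint iterM (R : realType) (n : nat) (A : Type) (k : nat)
    (f : A -> prog R n A) (a : A) : prog R n A :=
  if k is k'.+1 then Tick (let! a' := f a in iterM k' f a') else Ret a.

Definition sampleM (R : realType) (n : nat) (A : Type) (k : nat)
    (P : prog R n A) : prog R n (seq A) :=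
  iterM k (fun s => let! a := P in Ret (rcons s a)) [::].

(* Minimization by exhaustive search over [c0 :: s]; [tie c c'] says whether the
   candidate [c'] replaces the incumbent [c] when their scores are equal, so
   that a suitable [tie] selects any prescribed minimizer. *)
Definition argminM (R : realType) (n : nat) (C : Type) (tie : C -> C -> bool)
    (score : C -> prog R n R) (c0 : C) (s : seq C) : prog R n C :=
  let! v0 := score c0 in
  let! best := foldM (fun best c =>
      let! v := score c in
      step (if (v < best.2) || ((v == best.2) && tie best.1 c)
            then (c, v) else best)) (c0, v0) s in
  Ret best.1.

(* [(b, A)] is the signed parity [pm b * chi_A]. *)
Definition sparity (n : nat) := (bool * {set 'I_n})%type.

Definition sparity_val {R : realType} (n : nat) (W : sparity n) (x : cube n) : R :=
  pm W.1 * \prod_(i in W.2) pm (x i).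

Definition sparities (n d : nat) : seq (sparity n) :=
  enum [pred W : sparity n | (#|W.2| <= d)%N].

Definition sparityM (R : realType) (n : nat) (W : sparity n) (x : cube n)
  : prog R n R :=
  foldM (fun v i => step (v * pm (x i))) (pm W.1) (enum W.2).

Definition erm (R : realType) (n d : nat)
    (tieW : seq (example n) -> sparity n -> sparity n -> bool)
    (data : seq (example n)) : prog R n (sparity n) :=
  argminM (tieW data)
    (fun W =>
       let! c := foldM (fun c z =>
           let! w := sparityM R W z.1 in
           step (c + (w != pm z.2)%:R)) 0 data in
       step (c / (size data)%:R))
    (true, finset.set0) (sparities n d).

Definition phi {R : realType} (z : R) : R :=
  if z <= 0 then 2 - z else (z + 2) * expR (- z).

(* The function [h_t]: either the weak learner's output divided by the edge, or
   [- sign(H_t)]. *)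
Inductive rule (n : nat) := Scaled of sparity n | NegSign.
Arguments NegSign {n}.

(* [v] is the value of [H_t x]. *)
Definition rule_val {R : realType} (n : nat) (gamma : R) (h : rule n) (v : R)
    (x : cube n) : R :=
  match h with
  | Scaled W => sparity_val W x / gamma
  | NegSign => - pm (0 <= v)
  end.

(* [H_(t+1) x] when [hs] lists [h_1, ..., h_t]. *)
Definition ensemble {R : realType} (n : nat) (gamma eta : R) (hs : seq (rule n))
    (x : cube n) : R :=
  foldl (fun v h => v + eta * rule_val gamma h v x) 0 hs.

Definition ruleM (R : realType) (n : nat) (gamma : R) (h : rule n) (v : R)
    (x : cube n) : prog R n R :=
  match h with
  | Scaled W => let! w := sparityM R W x in step (w / gamma)
  | NegSign => step (- pm (0 <= v))
  end.

Definition ensembleM (R : realType) (n : nat) (gamma eta : R) (hs : seq (rule n))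
    (x : cube n) : prog R n R :=
  foldM (fun v h => let! w := ruleM gamma h v x in step (v + eta * w)) 0 hs.

(* [v], [w] are the values at [x] of [H_(t-1)], [h_(t-1)], and [u] is [eta']. *)
Definition relabel_prob {R : realType} (eta sigma v w : R) (y : bool) (u : R) : R :=
  1 / 2 - (sigma * derive1 phi (pm y * v) * pm y
           + eta * derive1n 2 phi (pm y * (v + u * w)) * w)
          / (2 * (eta + sigma)).

Record params (R : realType) := Params {
  eta : R;       (* step size *)
  sigma : R;     (* mixing parameter *)
  tau : R;       (* branching tolerance *)
  rounds : nat;  (* number of iterations, T *)
  fresh : nat;   (* per-iteration sample size, S *)
  resamp : nat;  (* resampling parameter, m *)
  final : nat    (* post-selection sample size, S_0 *) }.

Definition admissible (R : realType) (pr : params R) : Prop :=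
  [/\ 0 < eta pr, 0 < sigma pr <= 1, (0 < rounds pr)%N, (0 < fresh pr)%N
    & (0 < resamp pr)%N /\ (0 < final pr)%N].

(* What round [t] hands to round [t + 1]: the list of [h_1, ..., h_(t-1)], the
   rule [h_t], and a procedure sampling from the distribution [D_t].  [None] is
   the state before the first round. *)
Definition state (R : realType) (n : nat) :=
  option (seq (rule n) * rule n * prog R n (example n)).

Definition rules_of (R : realType) (n : nat) (st : state R n) : seq (rule n) :=
  if st is Some (hs, h, _) then rcons hs h else [::].

Definition round_sampler (R : realType) (n : nat) (gamma : R) (pr : params R)
    (st : state R n) (data : seq (example n)) : prog R n (example n) :=
  match st with
  | None => pick data
  | Some (hs, h, prev) =>
      Coin (sigma pr) (fun b : bool =>
        if b then
          Unif (eta pr) (fun u =>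
            let! z := pick data in
            let! v := ensembleM gamma (eta pr) hs z.1 in
            let! w := ruleM gamma h v z.1 in
            let! p := step (relabel_prob (eta pr) (sigma pr) v w z.2 u) in
            Coin p (fun y => Ret (z.1, y)))
        else prev)
  end.

Definition round (R : realType) (n d : nat) (gamma : R) (pr : params R)
    (tieW : seq (example n) -> sparity n -> sparity n -> bool)
    (st : state R n) : prog R n (state R n) :=
  let! data := sampleM (fresh pr) draw in
  let sampler := round_sampler gamma pr st data in
  let! redata := sampleM (resamp pr) sampler in
  let! W := erm R d tieW redata in
  let! c := foldM (fun c z =>
      let! w := sparityM R W z.1 in step (c + pm z.2 * w)) 0 redata in
  let! h := step (if tau pr < c / (size redata)%:R then Scaled W else NegSign) in
  Ret (Some (rules_of st, h, sampler)).

(* The index [t] of the selection step stands for [H_(t+1)], [t < T]. *)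
Definition boost (R : realType) (n d : nat) (gamma : R) (pr : params R)
    (tieW : seq (example n) -> sparity n -> sparity n -> bool)
    (tie0 : seq (rule n) -> seq (example n) -> nat -> nat -> bool)
  : prog R n (classifier n) :=
  let! st := iterM (rounds pr) (round d gamma pr tieW) None in
  let hs := rules_of st in
  let! data0 := sampleM (final pr) draw in
  let! t := argminM (tie0 hs data0)
    (fun t =>
       let! c := foldM (fun c z =>
           let! v := ensembleM gamma (eta pr) (take t hs) z.1 in
           step (c + pm z.2 * pm (0 <= v))) 0 data0 in
       step (- c))
    0%N (iota 0 (rounds pr)) in
  Ret (fun x => 0 <= ensemble gamma (eta pr) (take t hs) x).

(* Main.v *)
Require Import Defs.
From mathcomp Require Import all_boot all_order all_algebra.
From mathcomp Require Import all_classical all_reals all_analysis.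
From mathcomp Require Import ring lra zify.

(* With mixing parameter 1 the momentum disappears: averaging the relabelling
   probability over eta' in [0, eta] integrates phi'' along the last step, so in
   every round the correlation of a parity with the relabelled data is, up to
   the factor 1 + eta and a sampling error controlled by Hoeffding's inequality,
   the derivative of the potential E[phi(y H(x))] in the direction of that
   parity.  If some parity of degree at most d has a large derivative, then the
   step along it decreases the potential.  Otherwise every halfspace f has a
   small derivative, because f is close in mean square to a polynomial of degree
   d with coefficients of l1 norm at most 2 n^d (Peres' noise sensitivity bound);
   since 0 <= -phi' <= 1 with equality on the errors of sign(H), either sign(H)
   is nearly as good as f or the step along -sign(H) decreases the potential.
   The potential starts at 2 and stays nonnegative, so some round is good. *)

Set Implicit Arguments.
Unset Strict Implicit.
Unset Printing Implicit Defensive.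

Import Order.TTheory GRing.Theory Num.Theory.
Import numFieldNormedType.Exports.
Local Open Scope ring_scope.

(** * The potential and the relabelling probabilities *)


(** The edge fixes all scales. Coefficients of l1 norm up to [2 n^d] turn an error in the
    derivatives along parities into one [2 n^d] times larger for halfspaces, so those derivatives
    must be known to order [gamma * eps] with [gamma = n^-d]: up to logarithms, about
    [(gamma * eps)^-2] fresh examples per round. A step along a parity is scaled by [1 / gamma], so
    smoothness of the potential asks for [eta] of order [gamma^2 * eps]; a round then gains order
    [(gamma * eps)^2], and [(gamma * eps)^-2] rounds suffice. The same smallness, [eta <= gamma^2],
    makes every relabelling bias a probability. The sample count is thus about [n^(4 d) * eps^-4]. A
    halfspace has spectral mass at most [3 / sqrt d] above degree [d]; asking for [eps^2] there
    gives [d] near [9 * eps^-4], and an exponent of at most [40 * eps^-4] plus one more [eps^-4] for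
    the logarithm. Examples are fresh in each round, so concentration is only needed for a fixed
    ensemble, uniformly over the parities. *)

Definition dphi {R : realType} (z : R) : R :=
  if z <= 0 then -1 else - ((z + 1) * expR (- z)).

Definition ddphi {R : realType} (z : R) : R :=
  if z <= 0 then 0 else z * expR (- z).

(** Meant for the gluing point 0 of the piecewise definitions, where neither branch describes the
    function on a whole neighbourhood. *)
Lemma is_derive_quadratic (R : realType) (f : R -> R) (a l : R) :
  (forall h, `|f (h + a) - f a - l * h| <= h ^+ 2) -> is_derive a 1 f l.
Proof.
move=> fl.
have cv : (h^-1 *: (f (h *: (1:R) + a) - f a) @[h --> 0^'] --> l)%classic.
  apply/cvgrPdist_le => /= e e0; near=> h.
  have h0 : h != 0 by near: h; exact: nbhs_dnbhs_neq.
  rewrite distrC.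
  have -> : h^-1 *: (f (h *: (1:R) + a) - f a) - l =
            h^-1 * (f (h + a) - f a - l * h).
    by rewrite scaler1 [LHS]/=; rewrite /GRing.scale/=; field.
  rewrite normrM normfV ler_pdivrMl ?normr_gt0//.
  rewrite (le_trans (fl h))// -real_normK ?num_real// expr2 ler_wpM2l//.
  near: h; apply: dnbhs0_le; exact: e0.
split; first by apply/cvg_ex; exists l.
exact: cvg_lim cv.
Unshelve. all: by end_near. Qed.

Lemma expRN_le (R : realType) (h : R) : 0 <= h -> expR (- h) <= (1 + h)^-1.
Proof.
move=> h0; rewrite expRN lef_pV2 ?posrE ?expR_gt0 ?expR_ge1Dx//.
by rewrite ltr_wpDr.
Qed.

Lemma expRN_ge (R : realType) (h : R) : 1 - h <= expR (- h).
Proof. by rewrite (le_trans _ (expR_ge1Dx _)). Qed.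

Lemma is_derive_expRN (R : realType) (z : R) :
  is_derive z 1 (fun x => expR (- x)) (- expR (- z)).
Proof.
have d1 : is_derive (- z) 1 expR (expR (- z)) by exact: is_derive_expR.
have d2 : is_derive z 1 (fun x : R => - x) (-1) by apply: is_derive_eq.
by apply: (is_derive_eq (is_derive1_comp d1 d2)); rewrite mulrN1.
Qed.

Lemma is_derive_affine_expRN (R : realType) (c z : R) :
  is_derive z 1 (fun x => (x + c) * expR (- x)) ((1 - z - c) * expR (- z)).
Proof.
have d := is_derive_expRN z.
have d' : is_derive z 1 (fun x : R => x + c) 1 by apply: is_derive_eq; rewrite addr0.
by apply: (is_derive_eq (is_deriveM d' d)); rewrite /GRing.scale/=; ring.
Qed.

Lemma is_derive_phi (R : realType) (z : R) : is_derive z 1 phi (dphi z).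
Proof.
case: (ltrgtP z 0) => z0.
- rewrite /dphi (ltW z0).
  apply: (@near_eq_is_derive _ _ _ (fun x : R => 2 - x)).
    near=> x; have x0 : x < 0 by near: x; exact: lt_nbhsl.
    by rewrite /phi (ltW x0).
  by apply: is_derive_eq; lra.
- rewrite /dphi leNgt z0/=.
  apply: (@near_eq_is_derive _ _ _ (fun x : R => (x + 2) * expR (- x))).
    near=> x; have x0 : 0 < x by near: x; exact: lt_nbhsr.
    by rewrite /phi leNgt x0.
  by apply: (is_derive_eq (is_derive_affine_expRN 2 z)); ring.
- rewrite z0; apply: is_derive_quadratic => h; rewrite addr0 /phi/dphi lexx.
  case: (leP h 0) => h0.
    have -> : 2 - h - (2 - 0) - -1 * h = 0 :> R by ring.
    by rewrite normr0 sqr_ge0.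
  (* The sandwich [1 - h <= expR (- h) <= 1 / (1 + h)] is accurate to second order, which is all
     that [is_derive_quadratic] asks for. *)
  have e1 := expRN_ge h; have e2 := expRN_le (ltW h0).
  have e3 : (h + 2) * expR (- h) <= 2 - h + h ^+ 2.
    apply: (le_trans (ler_wpM2l _ e2)); first lra.
    rewrite ler_pdivrMr; last lra.
    rewrite -subr_ge0.
    have -> : (2 - h + h ^+ 2) * (1 + h) - (h + 2) = h ^+ 3 by ring.
    exact/exprn_ge0/ltW.
  have e4 : (h + 2) * (1 - h) <= (h + 2) * expR (- h).
    by rewrite ler_wpM2l//; lra.
  by rewrite ler_norml; apply/andP; split; nra.
Unshelve. all: by end_near. Qed.

Lemma is_derive_dphi (R : realType) (z : R) : is_derive z 1 dphi (ddphi z).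
Proof.
case: (ltrgtP z 0) => z0.
- rewrite /ddphi (ltW z0).
  apply: (@near_eq_is_derive _ _ _ (fun x : R => -1 : R)).
    near=> x; have x0 : x < 0 by near: x; exact: lt_nbhsl.
    by rewrite /dphi (ltW x0).
- rewrite /ddphi leNgt z0/=.
  apply: (@near_eq_is_derive _ _ _ (- (fun x : R => (x + 1) * expR (- x)))).
    near=> x; have x0 : 0 < x by near: x; exact: lt_nbhsr.
    by rewrite /dphi leNgt x0.
  by apply: (is_derive_eq (is_deriveN (is_derive_affine_expRN 1 z))); ring.
- rewrite z0; apply: is_derive_quadratic => h; rewrite addr0 /ddphi/dphi lexx.
  case: (leP h 0) => h0.
    have -> : -1 - -1 - 0 * h = 0 :> R by ring.
    by rewrite normr0 sqr_ge0.
  have e1 := expRN_ge h; have e2 := expRN_le (ltW h0).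
  have e3 : (h + 1) * expR (- h) <= 1.
    apply: (le_trans (ler_wpM2l _ e2)); first lra.
    by rewrite ler_pdivrMr; lra.
  have e4 : (h + 1) * (1 - h) <= (h + 1) * expR (- h).
    by rewrite ler_wpM2l//; lra.
  by rewrite ler_norml; apply/andP; split; nra.
Unshelve. all: by end_near. Qed.

Lemma derive1_phi (R : realType) : derive1 (@phi R) = dphi.
Proof. by apply/funext => z; rewrite derive1E; have [_] := is_derive_phi z. Qed.

Lemma derive2_phi (R : realType) : derive1n 2 (@phi R) = ddphi.
Proof.
rewrite /derive1n/= derive1_phi; apply/funext => z.
by rewrite derive1E; have [_] := is_derive_dphi z.
Qed.

Lemma is_derive_continuous (R : realType) (f : R -> R) (x l : R) :
  is_derive x 1 f l -> {for x, continuous f}.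
Proof. by move=> d; apply/differentiable_continuous/derivable1_diffP; case: d. Qed.

Lemma dphi_continuous (R : realType) : continuous (@dphi R).
Proof. by move=> x; exact: is_derive_continuous (is_derive_dphi x). Qed.

(** [ddphi] has a kink at 0, so continuity cannot come from a derivative as for [dphi]; writing it
    with a maximum removes the case split. *)
Lemma ddphi_continuous (R : realType) : continuous (@ddphi R).
Proof.
have -> : @ddphi R = (fun z => Num.max z 0 * expR (- Num.max z 0)).
  apply/funext => z; rewrite /ddphi; case: (leP z 0) => z0.
    by rewrite mul0r.
  by [].
move=> x; apply: cvgM.
  by apply: continuous_max => //; exact: cvg_cst.
apply: (@continuous_comp _ _ _ (fun z : R => - Num.max z 0) expR).
  by apply: cvgN; apply: continuous_max => //; exact: cvg_cst.
exact: continuous_expR.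
Qed.

Lemma dphi_lt0 (R : realType) (z : R) : dphi z < 0.
Proof.
rewrite /dphi; case: (leP z 0) => z0; first by rewrite ltrN10.
by rewrite oppr_lt0 mulr_gt0 ?expR_gt0// ltr_wpDr.
Qed.

Lemma dphi_geN1 (R : realType) (z : R) : -1 <= dphi z.
Proof.
rewrite /dphi; case: (leP z 0) => z0 //; rewrite lerN2.
apply: (le_trans (ler_wpM2l _ (expRN_le (ltW z0)))); first lra.
by rewrite ler_pdivrMr; lra.
Qed.

Lemma ddphi_ge0 (R : realType) (z : R) : 0 <= ddphi z.
Proof.
rewrite /ddphi; case: (leP z 0) => z0 //.
by rewrite mulr_ge0 ?expR_ge0// ltW.
Qed.

Lemma ddphi_le1 (R : realType) (z : R) : ddphi z <= 1.
Proof.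
rewrite /ddphi; case: (leP z 0) => z0 //.
apply: (le_trans (ler_wpM2l (ltW z0) (expRN_le (ltW z0)))).
by rewrite ler_pdivrMr; lra.
Qed.

Lemma phi_ge0 (R : realType) (z : R) : 0 <= phi z.
Proof.
rewrite /phi; case: (leP z 0) => z0; first lra.
by rewrite mulr_ge0 ?expR_ge0//; lra.
Qed.

Lemma dphi_lip (R : realType) (a b : R) : a <= b -> 0 <= dphi b - dphi a <= b - a.
Proof.
move=> ab; have [|c _ ->] := MVT_segment ab (fun x _ => is_derive_dphi x).
  by apply: continuous_subspaceT => x; exact: dphi_continuous.
have h : 0 <= b - a by rewrite subr_ge0.
by rewrite mulr_ge0 ?ddphi_ge0//= ler_piMl// ddphi_le1.
Qed.

Lemma phi_smooth (R : realType) (z h : R) :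
  phi (z + h) <= phi z + dphi z * h + h ^+ 2 / 2.
Proof.
(* The function [x |-> phi (z + x) - dphi z * x - x^2 / 2] has derivative
   [dphi (z + x) - dphi z - x], of sign opposite to [x] because [dphi] is 1-Lipschitz; hence it is
   largest at 0. *)
have main (a b : R) : a <= b ->
    exists2 c, a <= c <= b & phi (z + b) - dphi z * b - b ^+ 2 / 2 -
      (phi (z + a) - dphi z * a - a ^+ 2 / 2) = (dphi (z + c) - dphi z - c) * (b - a).
  move=> ab.
  have dF (x : R) : is_derive x 1 (fun x : R => phi (z + x) - dphi z * x - x ^+ 2 / 2)
      (dphi (z + x) - dphi z - x).
    have d1 : is_derive (z + x) 1 phi (dphi (z + x)) by exact: is_derive_phi.
    have d2 : is_derive x 1 (fun x : R => z + x) 1.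
      by apply: is_derive_eq; rewrite add0r mulr1.
    have d3 : is_derive x 1 (fun x : R => phi (z + x)) (dphi (z + x) * 1).
      exact: (is_derive1_comp d1 d2).
    have d4 : is_derive x 1 (fun x : R => - (dphi z * x) - x ^+ 2 / 2) (- dphi z - x).
      by apply: is_derive_eq; rewrite /GRing.scale/=; field.
    have -> : (fun x : R => phi (z + x) - dphi z * x - x ^+ 2 / 2) =
      (fun x : R => phi (z + x)) + (fun x : R => - (dphi z * x) - x ^+ 2 / 2).
      by apply/funext => y; rewrite /= addrA.
    by apply: (is_derive_eq (is_deriveD d3 d4)); ring.
  have [|c cab ->] := MVT_segment ab (fun x _ => dF x).
    apply: continuous_subspaceT => x; exact: is_derive_continuous (dF x).
  by exists c => //; rewrite in_itv in cab.
rewrite -subr_le0; case: (leP 0 h) => h0.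
  have [c /andP[c0 ch]] := main _ _ h0.
  have /andP[_ h1] : 0 <= dphi (z + c) - dphi z <= z + c - z by apply: dphi_lip; lra.
  rewrite addr0 => h2.
  suff : (dphi (z + c) - dphi z - c) * (h - 0) <= 0 by lra.
  by rewrite mulr_le0_ge0//; lra.
have [c /andP[hc c0]] := main _ _ (ltW h0).
have /andP[_ h1] : 0 <= dphi z - dphi (z + c) <= z - (z + c) by apply: dphi_lip; lra.
rewrite addr0 => h2.
suff : 0 <= (dphi (z + c) - dphi z - c) * (0 - h) by lra.
by rewrite mulr_ge0//; lra.
Qed.

Lemma sqr_pm (R : realType) (b : bool) : pm b * pm b = 1 :> R.
Proof. by case: b; rewrite /pm ?mulrNN mulr1. Qed.

Lemma normr_pm (R : realType) (b : bool) : `|pm b : R| = 1.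
Proof. by case: b; rewrite /pm ?normrN normr1. Qed.

Lemma expR_ge_quadratic (R : realType) (s : R) : 0 <= s -> 1 + s + s ^+ 2 / 4 <= expR s.
Proof.
move=> s0; have e := expR_ge1Dx (s / 2).
have -> : expR s = expR (s / 2) * expR (s / 2) by rewrite -expRD; congr expR; field.
have -> : 1 + s + s ^+ 2 / 4 = (1 + s / 2) * (1 + s / 2) by field.
by rewrite ler_pM//; lra.
Qed.

(* Multiplying by [expR s], the bound follows from [expR s - 1 - s >= s^2 / 4]
   and AM-GM. *)
Lemma ddphi_scaled_le (R : realType) (eta w s : R) : 0 < eta -> eta * w ^+ 2 <= 1 ->
  0 <= s -> eta * (`|w| * ddphi s) <= 1 + dphi s + eta.
Proof.
move=> eta0 ew s0.
have [->|sn0] := eqVneq s 0.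
  by rewrite /ddphi /dphi lexx !mulr0; lra.
have sp : 0 < s by rewrite lt0r sn0.
have /negbTE sf : ~~ (s <= 0) by rewrite -ltNge.
rewrite /ddphi /dphi sf.
have E : expR s * expR (- s) = 1 by rewrite -expRD subrr expR0.
have e0 := expR_gt0 (- s).
have q := expR_ge_quadratic s0.
have am : eta * `|w| * s <= s ^+ 2 / 4 + eta.
  have := sqr_ge0 (s / 2 - eta * `|w|).
  have : eta ^+ 2 * `|w| ^+ 2 <= eta by rewrite real_normK ?num_real//; nra.
  by rewrite sqrrB exprMn => h1 h2; lra.
have : (eta * `|w| * s) * expR (- s) <= (s ^+ 2 / 4 + eta) * expR (- s).
  by rewrite ler_wpM2r// ltW.
have : (1 + s + s ^+ 2 / 4) * expR (- s) <= expR s * expR (- s).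
  by rewrite ler_wpM2r// ltW.
have : expR (- s) <= 1 by rewrite -expR0 ler_expR; lra.
by rewrite E => h1 h2 h3; nra.
Qed.

(* If [w] and [y] agree then [ddphi] is evaluated at a larger point and the two
   terms have opposite signs; otherwise it is evaluated at a smaller point, and
   [dphi] is nondecreasing. *)
Lemma relabel_prob_bounds (R : realType) (eta v w : R) (y : bool) (u : R) :
  0 < eta -> eta * w ^+ 2 <= 1 -> eta * `|w| <= 1 -> 0 <= u <= eta ->
  0 <= relabel_prob eta 1 v w y u <= 1.
Proof.
move=> eta0 ew ew1 /andP[u0 ue].
rewrite /relabel_prob derive1_phi derive2_phi !mul1r.
set z := pm y * v; set s := pm y * (v + u * w).
have es : s = z + u * (pm y * w) by rewrite /s /z; ring.
have nw : `|pm y * w| = `|w|.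
  by rewrite normrM normr_pm mul1r.
suff main : `|dphi z + eta * ddphi s * (pm y * w)| <= 1 + eta.
  have e2 : 0 < 2 * (eta + 1) by lra.
  have E : dphi z * pm y + eta * ddphi s * w =
           pm y * (dphi z + eta * ddphi s * (pm y * w)).
    by rewrite /pm; case: (y); ring.
  rewrite E.
  have : `|pm y * (dphi z + eta * ddphi s * (pm y * w))| <= 1 + eta.
    by rewrite normrM normr_pm mul1r.
  rewrite ler_norml => /andP[h1 h2].
  rewrite subr_ge0 ler_pdivrMr// lerBlDl -lerBlDr ler_pdivlMr//.
  by apply/andP; split; lra.
move: es nw; set x := pm y * w => es nw.
have d1 := dphi_geN1 z; have d2 := dphi_lt0 z.
have dd0 := ddphi_ge0 s; have dd1 := ddphi_le1 s.
have [x0|x0] := leP 0 x.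
  rewrite ger0_norm// in nw.
  have : eta * ddphi s * x <= 1.
    have h : eta * x <= 1 by rewrite nw.
    have : (eta * x) * ddphi s <= 1 by rewrite mulr_ile1 // mulr_ge0 // ltW.
    by rewrite mulrAC.
  have : 0 <= eta * ddphi s * x by rewrite mulr_ge0// mulr_ge0// ltW.
  move=> h1 h2; rewrite ler_norml; apply/andP; split; lra.
rewrite ltr0_norm// in nw.
have [s0|s0] := leP 0 s; last first.
  by rewrite {1}/ddphi (ltW s0) mulr0 mul0r addr0 ler_norml; apply/andP; split; lra.
have := ddphi_scaled_le eta0 ew s0; rewrite -nw => h1.
have sz : s <= z by rewrite es gerDl; nra.
have /andP[h2 _] := dphi_lip sz.
rewrite ler_norml; apply/andP; split; first lra.
have : 0 <= eta * ddphi s * - x by rewrite mulr_ge0 ?mulr_ge0 ?(ltW eta0)//; lra.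
lra.
Qed.

(** * Expectation as a positive linear functional *)


Lemma expect_bind (R : realType) (n : nat) (A B : Type) (D : distr R n)
    (g : B -> R) (P : prog R n A) (f : A -> prog R n B) :
  expect D g (bind P f) = expect D (fun a => expect D g (f a)) P.
Proof.
elim: P => //= [k IH|p k IH|a k IH|N k IH].
- by apply: eq_bigr => z _; rewrite IH.
- by rewrite !IH.
- by congr (_ * _); apply: eq_Rintegral => u _; rewrite IH.
- by congr (_ * _); apply: eq_bigr => i _; rewrite IH.
Qed.

(* Not automatic: at a [Unif] node, linearity and monotonicity of [expect] need
   integrability. [I] is a property of all possible results. *)
Record lawful (R : realType) (n : nat) (A : Type) (D : distr R n)
    (I : A -> Prop) (P : prog R n A) : Prop := Lawful {
  expect_lin : forall c (f g : A -> R),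
    expect D (fun a => c * f a + g a) P = c * expect D f P + expect D g P;
  expect_le : forall f g : A -> R, (forall a, I a -> f a <= g a) ->
    expect D f P <= expect D g P;
  expect1 : expect D (fun=> 1) P = 1 }.

Section Lawful.
Variables (R : realType) (n : nat) (D : distr R n).

Section Functional.
Variables (A : Type) (I : A -> Prop) (P : prog R n A) (lP : lawful D I P).
Implicit Types f g : A -> R.

Lemma expect_eq f g : (forall a, I a -> f a = g a) -> expect D f P = expect D g P.
Proof.
by move=> fg; apply/eqP; rewrite eq_le !(expect_le lP)// => a /fg ->.
Qed.

Lemma expect0 : expect D (fun _ : A => 0) P = 0.
Proof.
have := expect_lin lP (-1) (fun=> 1) (fun=> 1); by rewrite (expect1 lP) mulN1r addNr.
Qed.

Lemma expectZ c f : expect D (fun a => c * f a) P = c * expect D f P.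
Proof.
rewrite -[RHS]addr0 -expect0 -(expect_lin lP).
by apply: expect_eq => a _; rewrite addr0.
Qed.

Lemma expectD f g : expect D (fun a => f a + g a) P = expect D f P + expect D g P.
Proof.
rewrite -[X in X + _]mul1r -(expect_lin lP).
by apply: expect_eq => a _; rewrite mul1r.
Qed.

Lemma expect_cst c : expect D (fun=> c) P = c.
Proof. by rewrite -[RHS]mulr1 -(expect1 lP) -expectZ; apply: expect_eq => a _; rewrite mulr1. Qed.

Lemma expectB f g : expect D (fun a => f a - g a) P = expect D f P - expect D g P.
Proof.
rewrite -[X in _ - X]mul1r -mulNr addrC -(expect_lin lP).
by apply: expect_eq => a _; rewrite mulN1r addrC.
Qed.

Lemma expect_sum (J : Type) (s : seq J) (F : J -> A -> R) :
  expect D (fun a => \sum_(j <- s) F j a) P = \sum_(j <- s) expect D (F j) P.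
Proof.
elim: s => [|j s IH].
  by rewrite big_nil -[RHS]expect0; apply: expect_eq => a _; rewrite big_nil.
rewrite big_cons -IH -expectD; apply: expect_eq => a _.
by rewrite big_cons.
Qed.

Lemma expect_bound f c : (forall a, I a -> `|f a| <= c) -> `|expect D f P| <= c.
Proof.
move=> fc; rewrite ler_norml -(expect_cst (- c)) -{2}(expect_cst c).
by rewrite !(expect_le lP)// => a /fc; rewrite ler_norml => /andP[].
Qed.

End Functional.

Lemma lawful_ret (A : Type) (I : A -> Prop) (a : A) : I a -> lawful D I (Ret a).
Proof. by move=> Ia; split => //= f g; exact. Qed.

Lemma lawful_tick (A : Type) (I : A -> Prop) (P : prog R n A) :
  lawful D I P -> lawful D I (Tick P).
Proof. by case=> l m o; split. Qed.

Lemma lawful_bind (A B : Type) (I : A -> Prop) (J : B -> Prop)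
    (P : prog R n A) (f : A -> prog R n B) :
  lawful D I P -> (forall a, I a -> lawful D J (f a)) -> lawful D J (bind P f).
Proof.
move=> lP lf; split.
- move=> c g h; rewrite !expect_bind -(expect_lin lP).
  by apply: (expect_eq lP) => a /lf lfa; rewrite (expect_lin lfa).
- move=> g h gh; rewrite !expect_bind; apply: (expect_le lP) => a /lf lfa.
  exact: (expect_le lfa).
- rewrite !expect_bind -[RHS](expect1 lP); apply: (expect_eq lP) => a /lf lfa.
  exact: expect1 lfa.
Qed.

Lemma lawful_example (A : Type) (I : A -> Prop) (k : example n -> prog R n A) :
  (forall z, lawful D I (k z)) -> lawful D I (Example k).
Proof.
move=> lk; split => /=.
- move=> c f g; rewrite mulr_sumr -big_split; apply: eq_bigr => z _ /=.
  by rewrite (expect_lin (lk z)) mulrDr mulrCA.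
- move=> f g fg; apply: ler_sum => z _; apply: ler_wpM2l; first exact: mass_ge0.
  exact: (expect_le (lk z)).
- rewrite -[RHS](mass_sum1 D); apply: eq_bigr => z _.
  by rewrite (expect1 (lk z)) mulr1.
Qed.

Lemma lawful_coin (A : Type) (I : A -> Prop) p (k : bool -> prog R n A) :
  0 <= p <= 1 -> (forall b, lawful D I (k b)) -> lawful D I (Coin p k).
Proof.
move=> /andP[p0 p1] lk; split => /=.
- move=> c f g; rewrite !(expect_lin (lk _)); ring.
- move=> f g fg; apply: lerD; apply: ler_wpM2l; rewrite ?subr_ge0//;
    exact: (expect_le (lk _)).
- by rewrite !(expect1 (lk _)); ring.
Qed.

(** With mixing parameter 1 the branch that calls the previous sampler has weight 0, so lawfulness
    of a sampler is settled by its own round, without an induction over rounds. *)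
Lemma lawful_coin1 (A : Type) (I : A -> Prop) (k : bool -> prog R n A) :
  lawful D I (k true) -> lawful D I (Coin 1 k).
Proof.
move=> lk; have E f : expect D f (Coin 1 k) = expect D f (k true).
  by rewrite /= subrr mul0r addr0 mul1r.
split=> [c f g|f g fg|]; rewrite !E; [exact: (expect_lin lk)|exact: (expect_le lk)|].
exact: expect1 lk.
Qed.

Lemma lawful_pick_ord (A : Type) (I : A -> Prop) N (k : 'I_N -> prog R n A) :
  (0 < N)%N -> (forall i, lawful D I (k i)) -> lawful D I (Defs.Pick k).
Proof.
move=> N0 lk; split => /=.
- move=> c f g; rewrite mulrCA [c * _]mulr_sumr -mulrDr -big_split; congr (_ * _).
  by apply: eq_bigr => i _ /=; rewrite (expect_lin (lk i)).
- move=> f g fg; apply: ler_wpM2l; first by rewrite invr_ge0.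
  by apply: ler_sum => i _; exact: (expect_le (lk i)).
- under eq_bigr do rewrite (expect1 (lk _)).
  by rewrite sumr_const card_ord mulVf// pnatr_eq0 -lt0n.
Qed.

Lemma continuous_itv_integrable (a b : R) (f : R -> R) : continuous f ->
  lebesgue_measure.-integrable `[a, b] (EFin \o f).
Proof.
move=> cf; apply: continuous_compact_integrable; first exact: segment_compact.
exact: continuous_subspaceT.
Qed.

(** Continuity in [u], for every test function, is how integrability on [[0, a]] is supplied. *)
Lemma lawful_unif (A : Type) (I : A -> Prop) a (k : R -> prog R n A) :
  0 < a -> (forall f, continuous (fun u => expect D f (k u))) ->
  (forall u, 0 <= u <= a -> lawful D I (k u)) -> lawful D I (Unif a k).
Proof.
move=> a0 ck lk.
split => /=.
- move=> c f g; rewrite mulrCA -mulrDr; congr (_ * _).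
  rewrite -RintegralZl//; last exact: continuous_itv_integrable.
  rewrite -RintegralD//; last 2 first.
  + apply: continuous_itv_integrable => u; apply: cvgM; [exact: cvg_cst|exact: ck].
  + exact: continuous_itv_integrable.
  by apply: eq_Rintegral => u; rewrite inE/= in_itv/= => /lk lku; rewrite (expect_lin lku).
- move=> f g fg; apply: ler_wpM2l; first by rewrite invr_ge0 ltW.
  apply: le_Rintegral => //; try exact: continuous_itv_integrable.
  by move=> u; rewrite /= in_itv/= => /lk lku; exact: (expect_le lku).
- under eq_Rintegral => u.
    by rewrite inE/= in_itv/= => /lk lku; rewrite (expect1 lku); over.
  rewrite Rintegral_cst//= lebesgue_measure_itv/= lte_fin a0 oppr0 adde0/= mul1r.
  by rewrite mulVf// gt_eqF.
Qed.

Lemma Rintegral_FTC (F f : R -> R) (a b : R) : a < b ->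
  (forall x : R, is_derive x 1 F (f x)) -> continuous f ->
  \int[lebesgue_measure]_(x in `[a, b]) f x = F b - F a.
Proof.
move=> ab dF cf; rewrite /Rintegral (@continuous_FTC2 _ f F)//.
- exact: continuous_subspaceT.
- have cF : continuous F by move=> x; exact: is_derive_continuous (dF x).
  split; first by move=> x _; case: (dF x).
  + by apply: cvg_at_right_filter; exact: cF.
  + by apply: cvg_at_left_filter; exact: cF.
- by move=> x _; rewrite derive1E; case: (dF x).
Qed.

End Lawful.

(** * Deterministic programs *)


(** Deterministic programs are syntactically ticks followed by a result, so one such equation yields
    their expectation, their lawfulness and their running time. *)
Definition computes (R : realType) (n : nat) (A : Type) (P : prog R n A)
    (t : nat) (v : A) : Prop :=
  exists2 k, (k <= t)%N & P = iter k Tick (Ret v).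

Section Computes.
Variables (R : realType) (n : nat).
Implicit Types (A B I : Type).

Lemma computes_ret A t (v : A) : computes (Ret v : prog R n A) t v.
Proof. by exists 0%N. Qed.

Lemma computes_step A t (v : A) : (0 < t)%N -> computes (step v : prog R n A) t v.
Proof. by exists 1%N. Qed.

Lemma computes_bind A B (P : prog R n A) (f : A -> prog R n B) t1 t2 v w :
  computes P t1 v -> computes (f v) t2 w -> computes (bind P f) (t1 + t2) w.
Proof.
move=> [k kt ->] [l lt E]; exists (k + l)%N; first exact: leq_add.
by rewrite iterD -E; elim: k {kt} => //= k ->.
Qed.

Lemma computes_leq A (P : prog R n A) t t' v :
  (t <= t')%N -> computes P t v -> computes P t' v.
Proof. by move=> tt [k kt ->]; exists k => //; exact: leq_trans tt. Qed.

Lemma computes_foldM I A (f : A -> I -> prog R n A) (g : A -> I -> A) t a (s : seq I) :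
  (forall a i, computes (f a i) t (g a i)) ->
  computes (foldM f a s) (size s * t.+1) (foldl g a s).
Proof.
move=> fg; elim: s a => [|i s IH] a; first by exists 0%N.
have [k kt E] := computes_bind (f := fun a' => foldM f a' s) (fg a i) (IH _).
exists k.+1; first by rewrite /= mulSn addSn ltnS.
by rewrite /= E.
Qed.

Lemma expect_computes A (D : distr R n) (f : A -> R) (P : prog R n A) t v :
  computes P t v -> expect D f P = f v.
Proof. by move=> [k _ ->]; elim: k. Qed.

Lemma expect_computes_bind A B (D : distr R n) (g : B -> R) (P : prog R n A)
    (f : A -> prog R n B) t v :
  computes P t v -> expect D g (bind P f) = expect D g (f v).
Proof. by move=> h; rewrite expect_bind (expect_computes _ _ h). Qed.

Lemma lawful_computes A (D : distr R n) (J : A -> Prop) (P : prog R n A) t v :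
  computes P t v -> J v -> lawful D J P.
Proof.
by move=> [k _ ->] Jv; elim: k => [|k IH]; [exact: lawful_ret|exact: lawful_tick].
Qed.

(** The fold keeps the incumbent together with its true score, minimal so far, whatever [tie]
    decides. [List.In] is used because [C] is an arbitrary type. *)
Lemma computes_argminM (C : Type) (tie : C -> C -> bool)
    (score : C -> prog R n R) (sc : C -> R) t c0 (s : seq C) :
  (forall c, computes (score c) t (sc c)) ->
  exists c, [/\ computes (argminM tie score c0 s) (t + size s * t.+2) c,
    List.In c (c0 :: s) & forall c', List.In c' (c0 :: s) -> sc c <= sc c'].
Proof.
move=> scP.
pose g (best : C * R) c :=
  if (sc c < best.2) || ((sc c == best.2) && tie best.1 c) then (c, sc c) else best.
pose best := foldl g (c0, sc c0) s.
have [sb ib mb] : [/\ best.2 = sc best.1, List.In best.1 (c0 :: s) &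
    forall c', List.In c' (c0 :: s) -> sc best.1 <= sc c'].
  rewrite /best; elim/last_ind: s {best} => [|s c [sb ib mb]].
    by split; [| left |move=> c' [<-|]].
  rewrite -cats1 foldl_cat /=; move: sb ib mb; set b := foldl _ _ _ => sb ib mb.
  have inl c' : List.In c' (c0 :: (s ++ [:: c])) <-> List.In c' (c0 :: s) \/ c' = c.
    by split=> [/= [->|/List.in_app_iff[|[|[]]]]|/= [[]|]]; rewrite ?List.in_app_iff /=; intuition.
  rewrite /g; case: ifPn => h /=.
    split=> //; first by apply/inl; right.
    have le : sc c <= sc b.1.
      by rewrite -sb; case/orP: h => [/ltW//|/andP[/eqP-> _]].
    by move=> c' /inl[/mb|->//]; exact: le_trans.
  split=> //; first by apply/inl; left.
  move=> c' /inl[/mb//|->].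
  by move: h; rewrite negb_or -leNgt sb => /andP[].
exists best.1; split=> //.
rewrite /argminM; apply: computes_bind; first exact: scP.
rewrite -[X in computes _ X _]addn0.
apply: computes_bind; last exact: computes_ret.
apply: (computes_foldM (g := g)) => a i.
rewrite -addn1; apply: computes_bind; first exact: scP.
exact: computes_step.
Qed.

Lemma foldl_sum (A : Type) (F : A -> R) c (s : seq A) :
  foldl (fun c z => c + F z) c s = c + \sum_(z <- s) F z.
Proof.
elim: s c => [|z s IH] c; first by rewrite big_nil addr0.
by rewrite /= IH big_cons addrA.
Qed.

Lemma computes_sparityM (W : sparity n) (x : cube n) :
  computes (sparityM R W x) (2 * n) (sparity_val W x).
Proof.
apply: (@computes_leq _ _ (size (enum W.2) * 2)).
  by rewrite mulnC leq_mul2l -cardE -[X in (_ <= X)%N](card_ord n) max_card.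
have -> : sparity_val W x = foldl (fun v i => v * pm (x i)) (pm W.1 : R) (enum W.2).
  rewrite /sparity_val -big_enum /=.
  elim: (enum _) (pm W.1) => [|i s IH] v /=; first by rewrite big_nil mulr1.
  by rewrite -IH big_cons mulrA.
by apply: computes_foldM => a i; exact: computes_step.
Qed.

Lemma computes_ruleM (gamma : R) (h : rule n) (v : R) (x : cube n) :
  computes (ruleM gamma h v x) (2 * n).+1 (rule_val gamma h v x).
Proof.
case: h => [W|] /=; last exact: computes_step.
by rewrite -addn1; apply: computes_bind (computes_sparityM _ _) _; exact: computes_step.
Qed.

Lemma computes_ensembleM (gamma eta : R) (hs : seq (rule n)) (x : cube n) :
  computes (ensembleM gamma eta hs x) (size hs * (2 * n).+3) (ensemble gamma eta hs x).
Proof.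
apply: computes_foldM => v h; rewrite -addn1.
by apply: computes_bind (computes_ruleM _ _ _ _) _; exact: computes_step.
Qed.

Definition avg (A : Type) (s : seq A) (X : A -> R) : R :=
  (\sum_(z <- s) X z) / (size s)%:R.

Lemma prod_pm (I : Type) (s : seq I) (x : I -> bool) :
  exists b, \prod_(i <- s) pm (x i) = pm b :> R.
Proof.
elim: s => [|i s [b IH]]; first by exists true; rewrite big_nil.
by exists (x i == b); rewrite big_cons IH; case: (x i); case: b {IH};
  rewrite /pm ?mulrNN ?mulr1 ?mul1r.
Qed.

Lemma sparity_val_pm (W : sparity n) (x : cube n) :
  exists b, sparity_val W x = pm b :> R.
Proof.
rewrite /sparity_val -big_enum /=.
have [b ->] := prod_pm (enum W.2) x.
by exists (W.1 == b); case: W.1; case: b;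
  rewrite /pm ?mulrNN ?mulr1 ?mul1r.
Qed.

Lemma neq_pm (a b : bool) : (pm a != pm b :> R)%:R = (1 - pm b * pm a) / 2 :> R.
Proof.
case: a; case: b; rewrite /pm ?eqxx ?mulrNN ?mulr1 ?mul1r ?mulN1r /=.
- by rewrite subrr mul0r.
- by rewrite -subr_eq0 opprK -(natrD _ 1 1) pnatr_eq0 /=; field.
- by rewrite eq_sym -subr_eq0 opprK -(natrD _ 1 1) pnatr_eq0 /=; field.
- by rewrite subrr mul0r.
Qed.

Lemma mem_In (T : eqType) (x : T) (s : seq T) : x \in s <-> List.In x s.
Proof.
elim: s => // y s IH; rewrite inE; split => [/orP[/eqP->|/IH]|/= [->|/IH->]];
  rewrite ?eqxx ?orbT //=; by [left|right].
Qed.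

(** The 0-1 loss of a sign is [(1 - correlation) / 2] by [neq_pm], so the minimizer of the empirical
    loss maximizes the empirical correlation. *)
Lemma computes_erm d tieW (data : seq (example n)) :
  exists W, [/\ computes (erm R d tieW data)
      (((size data * (2 * n).+2).+1 + size (sparities n d) *
        (size data * (2 * n).+2).+3)) W,
    (#|W.2| <= d)%N &
    forall W' : sparity n, (#|W'.2| <= d)%N ->
      avg data (fun z => pm z.2 * sparity_val W' z.1) <=
      avg data (fun z => pm z.2 * sparity_val W z.1)].
Proof.
pose sc W : R := (\sum_(z <- data) (sparity_val W z.1 != pm z.2 :> R)%:R) / (size data)%:R.
pose score (W : sparity n) : prog R n R :=
  let! c := foldM (fun c z => let! w := sparityM R W z.1 in
    step (c + (w != pm z.2)%:R)) 0 data in step (c / (size data)%:R).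
have scP W : computes (score W) (size data * (2 * n).+2).+1 (sc W).
  rewrite -addn1; apply: computes_bind; last exact: computes_step.
  rewrite -[X in computes _ _ X]add0r -foldl_sum; apply: computes_foldM => c z.
  rewrite -addn1; apply: computes_bind (computes_sparityM _ _) _.
  exact: computes_step.
have [W [cW inW minW]] := computes_argminM (tieW data) (true, finset.set0)
  (sparities n d) scP.
have inC W' : List.In W' ((true, finset.set0) :: sparities n d) <-> (#|W'.2| <= d)%N.
  rewrite -mem_In inE mem_enum inE; split => [/orP[/eqP->/=|//]|->]; last by rewrite orbT.
  by rewrite cards0.
exists W; split; [exact: cW | exact/inC |].
move=> W' /inC /minW; rewrite /sc /avg.
(* Division by 0 yields 0, so on an empty dataset both averages vanish. *)
have [->|dn0] := eqVneq data [::]; first by rewrite !big_nil !mul0r.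
have s0 : 0 < (size data)%:R :> R by rewrite ltr0n lt0n size_eq0.
rewrite !ler_pM2r ?invr_gt0//.
have E V : \sum_(z <- data) (sparity_val V z.1 != pm z.2 :> R)%:R =
   ((size data)%:R - \sum_(z <- data) pm z.2 * sparity_val V z.1) / 2 :> R.
  rewrite -[X in X%:R - _]sum1_size natr_sum -sumrB mulr_suml.
  by apply: eq_bigr => z _; have [b ->] := sparity_val_pm V z.1; rewrite neq_pm.
by rewrite !E; lra.
Qed.

End Computes.

(** * Concentration *)


(** From [expR (- t / 2) >= 1 - t / 2] one gets [expR t <= (1 - t / 2)^-2]. The threshold 1/3 comes
    from the identity [(1 - t / 2)^2 (1 + t + t^2) - 1 = (t / 2)^2 (1 - 3 t + t^2)]. *)
Lemma expR_le_quadratic (R : realType) (t : R) : t <= 1 / 3 -> expR t <= 1 + t + t ^+ 2.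
Proof.
move=> t3; have e := @expR_ge1Dx R (- (t / 2)).
have p : 0 < 1 - t / 2 by lra.
have E : expR (- (t / 2)) * expR (- (t / 2)) * expR t = 1.
  by rewrite -!expRD -[RHS]expR0; congr expR; field.
have q : (1 - t / 2) * (1 - t / 2) * expR t <= 1.
  rewrite -[leRHS]E; apply: ler_wpM2r; first exact: expR_ge0.
  by apply: ler_pM; lra.
have r : 1 <= (1 - t / 2) * (1 - t / 2) * (1 + t + t ^+ 2).
  rewrite -subr_ge0.
  have -> : (1 - t / 2) * (1 - t / 2) * (1 + t + t ^+ 2) - 1 =
    (t / 2) ^+ 2 * ((1 - 3 * t) + t ^+ 2) by field.
  by rewrite mulr_ge0 ?sqr_ge0// addr_ge0 ?sqr_ge0//; lra.
have pp : 0 < (1 - t / 2) * (1 - t / 2) by rewrite mulr_gt0.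
by rewrite -(ler_pM2l pp); exact: le_trans r.
Qed.

Section Sampling.
Variables (R : realType) (n : nat) (D : distr R n).

Lemma prob_bind (A B : Type) (I : A -> Prop) (J : B -> Prop) (bad : A -> bool)
    (E : B -> bool) (P : prog R n A) (f : A -> prog R n B) d1 d2 : 0 <= d2 ->
  lawful D I P -> (forall a, I a -> lawful D J (f a)) ->
  prob D bad P <= d1 -> (forall a, I a -> ~~ bad a -> prob D E (f a) <= d2) ->
  prob D E (bind P f) <= d1 + d2.
Proof.
move=> d20 lP lf Pd1 fd2; rewrite /prob expect_bind.
apply: le_trans (lerD Pd1 (lexx d2)).
rewrite -[d2 in leRHS](expect_cst lP) -(expectD lP).
apply: (expect_le lP) => a Ia; case: (boolP (bad a)) => /= ba.
  rewrite -[leLHS]addr0 lerD//.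
  rewrite -[leRHS](expect_cst (lf a Ia)); apply: (expect_le (lf a Ia)) => b _.
  by case: (E b).
by rewrite add0r fd2.
Qed.

Lemma prob_le (A : Type) (I : A -> Prop) (P : prog R n A) (E F : A -> bool) :
  lawful D I P -> (forall a, I a -> E a -> F a) -> prob D E P <= prob D F P.
Proof.
move=> lP EF; apply: (expect_le lP) => a Ia.
by case: (E a) (EF a Ia) => [->//|]; case: (F a).
Qed.

Lemma prob_has (A J : Type) (I : A -> Prop) (P : prog R n A) (E : J -> A -> bool)
    (s : seq J) c : lawful D I P -> (forall j, prob D (E j) P <= c) ->
  prob D (fun a => has (E^~ a) s) P <= (size s)%:R * c.
Proof.
move=> lP Ec.
have -> : (size s)%:R * c = \sum_(j <- s) c.
  by rewrite -[in LHS]sum1_size natr_sum mulr_suml; apply: eq_bigr => j _; rewrite mul1r.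
apply: le_trans (_ : \sum_(j <- s) prob D (E j) P <= _); last first.
  by apply: ler_sum => j _; exact: Ec.
rewrite -(expect_sum lP); apply: (expect_le lP) => a _.
elim: s => [|j s IH]; first by rewrite big_nil.
rewrite big_cons /=; case: (E j a) => /=; last by rewrite add0r.
by rewrite ler_wpDr// sumr_ge0.
Qed.

Lemma prob_compl (A : Type) (I : A -> Prop) (P : prog R n A) (E : A -> bool) :
  lawful D I P -> prob D E P = 1 - prob D (fun a => ~~ E a) P.
Proof.
move=> lP; rewrite /prob -[X in X - _](expect1 lP) -(expectB lP).
by apply: (expect_eq lP) => a _; case: (E a); rewrite ?subr0 ?subrr.
Qed.

(** The invariant is indexed by the number of rounds done, and the start index [i] is arbitrary so
    that the induction on [k] goes through. *)
Lemma lawful_iterM (A : Type) (J : nat -> A -> Prop) (f : A -> prog R n A) k a i :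
  J i a -> (forall j a, (j < i + k)%N -> J j a -> lawful D (J j.+1) (f a)) ->
  lawful D (J (i + k)%N) (Defs.iterM k f a).
Proof.
elim: k i a => [|k IH] i a Ja Jf; first by rewrite addn0; exact: lawful_ret.
apply: lawful_tick; apply: (lawful_bind (Jf i a _ Ja)); first by rewrite addnS ltnS leq_addr.
by move=> b Jb; rewrite -addSnnS; apply: IH => // j c ji; apply: Jf; rewrite -addSnnS.
Qed.

Lemma prob_iterM (A : Type) (J : nat -> A -> Prop) (bad : nat -> A -> bool)
    (f : A -> prog R n A) k a i d :
  0 <= d -> J i a -> ~~ bad i a ->
  (forall j a, (j < i + k)%N -> J j a -> lawful D (J j.+1) (f a)) ->
  (forall j a, (j < i + k)%N -> J j a -> ~~ bad j a -> prob D (bad j.+1) (f a) <= d) ->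
  prob D (bad (i + k)%N) (Defs.iterM k f a) <= k%:R * d.
Proof.
move=> d0; elim: k i a => [|k IH] i a Ja ba Jf bf.
  by rewrite addn0 mul0r /prob /= (negbTE ba).
rewrite [Defs.iterM _ _ _]/= -[k.+1]add1n natrD mulrDl mul1r.
have ik : (i < i + k.+1)%N by rewrite addnS ltnS leq_addr.
rewrite /prob [expect _ _ _]/= -/(prob D _ _).
apply: (prob_bind (I := J i.+1) (J := J (i + k.+1)%N) (bad := bad i.+1)).
- by rewrite mulr_ge0.
- exact: Jf.
- move=> b Jb; rewrite -addSnnS; apply: lawful_iterM => // j c ji.
  by apply: Jf; rewrite -addSnnS.
- exact: bf.
- move=> b Jb nb; rewrite add1n -addSnnS; apply: IH => // j c ji; [apply: Jf|apply: bf];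
    by rewrite -addSnnS.
Qed.

Lemma lawful_sampleM (A : Type) (I : A -> Prop) (P : prog R n A) k :
  lawful D I P -> lawful D (fun s => size s = k) (sampleM k P).
Proof.
move=> lP.
apply: (@lawful_iterM _ (fun i (s : seq A) => size s = i) _ k [::] 0%N) => // j s _ sj.
apply: (lawful_bind lP) => a _.
by apply: lawful_ret; rewrite size_rcons sj.
Qed.

Section Hoeffding.
Variables (A : Type) (I : A -> Prop) (P : prog R n A) (lP : lawful D I P).

(** The centred variable is at most 2, so [l <= 1 / 6] keeps the exponent below 1/3 and the
    quadratic bound on [expR] applies; its linear term has mean 0 and its square has mean at most
    1. *)
Lemma expect_exp_le (X : A -> R) l : (forall a, I a -> `|X a| <= 1) -> 0 <= l <= 1 / 6 ->
  expect D (fun a => expR (l * (X a - expect D X P))) P <= expR (l ^+ 2).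
Proof.
move=> X1 /andP[l0 l6]; set mu := expect D X P.
have mu1 : `|mu| <= 1 := expect_bound lP X1.
have muE : expect D (fun a => X a - mu) P = 0.
  by rewrite (expectB lP) (expect_cst lP) subrr.
have var : expect D (fun a => (X a - mu) ^+ 2) P <= 1.
  (* Since [X^2 <= 1], the square is dominated by an affine function of [X - mu], whose expectation
     is immediate. *)
  apply: le_trans (_ : expect D (fun a => -2 * mu * (X a - mu) + (1 - mu ^+ 2)) P <= _).
    apply: (expect_le lP) => a /X1 Xa.
    have : X a ^+ 2 <= 1 by rewrite -(real_normK (num_real _)) exprn_ile1.
    lra.
  rewrite (expect_lin lP) muE (expect_cst lP) mulr0 add0r.
  by rewrite gerBl sqr_ge0.
apply: le_trans (_ : expect D (fun a => l * (X a - mu) +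
  (l ^+ 2 * (X a - mu) ^+ 2 + 1)) P <= _).
  apply: (expect_le lP) => a /X1 Xa.
  have h : l * (X a - mu) <= 1 / 3.
    have d2 : X a - mu <= 2 by move: Xa mu1; rewrite !ler_norml => /andP[_ ?] /andP[? _]; lra.
    nra.
  by apply: le_trans (expR_le_quadratic h) _; rewrite exprMn; lra.
rewrite (expect_lin lP) muE mulr0 add0r (expect_lin lP) (expect1 lP).
rewrite addrC; apply: le_trans (expR_ge1Dx _).
by rewrite lerD2l ler_piMr// sqr_ge0.
Qed.

Lemma expect_exp_sum_le (X : A -> R) l k :
  (forall a, I a -> `|X a| <= 1) -> 0 <= l <= 1 / 6 ->
  expect D (fun s => expR (l * \sum_(a <- s) (X a - expect D X P))) (sampleM k P)
    <= expR (k%:R * l ^+ 2).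
Proof.
move=> X1 l6; have h := expect_exp_le X1 l6.
set mu := expect D X P in h *.
pose F s := expR (l * \sum_(a <- s) (X a - mu)).
suff main s : expect D F (Defs.iterM k (fun s => let! a := P in Ret (rcons s a)) s) <=
    F s * expR (k%:R * l ^+ 2).
  by apply: le_trans (main _) _; rewrite /F big_nil mulr0 expR0 mul1r.
elim: k s => [|k IH] s /=; first by rewrite mul0r expR0 mulr1.
rewrite !expect_bind.
have E a : F (rcons s a) = F s * expR (l * (X a - mu)).
  by rewrite /F -cats1 big_cat big_seq1 mulrDr expRD.
apply: le_trans (_ : expect D (fun a => F s * expR (k%:R * l ^+ 2) *
    expR (l * (X a - mu))) P <= _).
  apply: (expect_le lP) => a _ /=; apply: le_trans (IH _) _.
  by rewrite E mulrAC.
rewrite (expectZ lP) -natr1 mulrDl mul1r expRD mulrA.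
by apply: ler_wpM2l h; rewrite mulr_ge0 ?expR_ge0.
Qed.

Lemma hoeffding_upper (X : A -> R) e k : (forall a, I a -> `|X a| <= 1) -> 0 <= e <= 1 / 3 ->
  prob D (fun s => k%:R * e <= \sum_(a <- s) (X a - expect D X P)) (sampleM k P)
    <= expR (- (k%:R * e ^+ 2 / 4)).
Proof.
move=> X1 /andP[e0 e3].
have lS := lawful_sampleM k lP.
(* This [l] minimizes the Chernoff exponent [k l^2 - k l e], leaving [- k e^2 / 4]; [e <= 1 / 3]
   gives [l <= 1 / 6]. *)
pose l := e / 2.
have l6 : 0 <= l <= 1 / 6 by rewrite /l; lra.
have /= h := expect_exp_sum_le k X1 l6.
apply: le_trans (_ : expR (- (k%:R * l * e)) * expR (k%:R * l ^+ 2) <= _); last first.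
  by rewrite -expRD ler_expR /l; lra.
apply: le_trans (ler_wpM2l (expR_ge0 _) h).
rewrite -(expectZ lS); apply: (expect_le lS) => s _.
case: (leP (k%:R * e)) => [ks|_] /=; last by apply: mulr_ge0; exact: expR_ge0.
rewrite -expRD -[leLHS]expR0 ler_expR addrC subr_ge0.
have -> : k%:R * l * e = l * (k%:R * e) by ring.
by apply: ler_wpM2l ks; case/andP: l6.
Qed.

Lemma hoeffding (X : A -> R) e k : (0 < k)%N -> (forall a, I a -> `|X a| <= 1) ->
  0 <= e <= 1 / 3 ->
  prob D (fun s => e <= `|avg s X - expect D X P|) (sampleM k P)
    <= 2 * expR (- (k%:R * e ^+ 2 / 4)).
Proof.
move=> k0 X1 e13.
have lS := lawful_sampleM k lP.
have h1 := hoeffding_upper k X1 e13.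
have X1' a : I a -> `|- X a| <= 1 by rewrite normrN; exact: X1.
have h2 := hoeffding_upper k X1' e13.
have EN : expect D (fun a => - X a) P = - expect D X P.
  by rewrite -mulN1r -(expectZ lP); apply: (expect_eq lP) => a _; rewrite mulN1r.
rewrite EN in h2.
rewrite mulr_natl mulr2n; apply: le_trans (lerD h1 h2).
rewrite -(expectD lS); apply: (expect_le lS) => s sk.
have kp : 0 < k%:R :> R by rewrite ltr0n.
have E1 : \sum_(a <- s) (X a - expect D X P) = k%:R * (avg s X - expect D X P).
  rewrite /avg sk sumrB big_const_seq count_predT sk iter_addr_0 -mulr_natl.
  by field; rewrite gt_eqF.
have E2 : \sum_(a <- s) (- X a - - expect D X P) = k%:R * - (avg s X - expect D X P).
  by rewrite mulrN -E1 -sumrN; apply: eq_bigr => a _; rewrite opprB opprK addrC.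
rewrite E1 E2 !ler_pM2l// ler_normr.
by case: (e <= _); case: (e <= _); rewrite /= ?addr0 ?add0r // lerDl.
Qed.

End Hoeffding.

Lemma expect_draw (f : example n -> R) : expect D f draw = \sum_z D z * f z.
Proof.
suff main m : expect D f (iter m Tick (Example Ret)) = \sum_z D z * f z by exact: main.
by elim: m => //= m ->.
Qed.

Lemma lawful_draw : lawful D (fun=> True) draw.
Proof.
suff main m : lawful D (fun=> True) (iter m Tick (Example Ret)) by exact: main.
elim: m => [|m IH] /=; last exact: lawful_tick.
by apply: lawful_example => z; exact: lawful_ret.
Qed.

Lemma expect_pick (A : Type) (s : seq A) (f : A -> R) : expect D f (Defs.pick s) = avg s f.
Proof. by rewrite /avg /= mulrC [in RHS]big_tnth. Qed.

Lemma lawful_pick (A : Type) (s : seq A) : (0 < size s)%N -> lawful D (fun=> True) (Defs.pick s).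
Proof. by move=> s0; apply: lawful_pick_ord => // i; exact: lawful_ret. Qed.

End Sampling.

(** * The relabelled distribution *)


Section Sampler.
Variables (R : realType) (n : nat).

Lemma continuous_avg (A : Type) (s : seq A) (F : A -> R -> R) :
  (forall a, continuous (F a)) -> continuous (fun u => avg s (F^~ u)).
Proof.
move=> cF; rewrite /avg => u; apply: cvgM; last exact: cvg_cst.
elim: s => [|a s IH].
  under eq_fun do rewrite big_nil.
  by rewrite big_nil; exact: cvg_cst.
under eq_fun do rewrite big_cons.
by rewrite big_cons; apply: cvgD => //; exact: cF.
Qed.

Lemma is_derive_avg (A : Type) (s : seq A) (F f : A -> R -> R) (u : R) :
  (forall a, is_derive u 1 (F a) (f a u)) ->
  is_derive u 1 (fun u => avg s (F^~ u)) (avg s (f^~ u)).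
Proof.
move=> dF.
have dS : is_derive u 1 (fun u => \sum_(a <- s) F a u) (\sum_(a <- s) f a u).
  elim: s => [|a s IH].
    rewrite big_nil; have -> : (fun u => \sum_(a <- [::]) F a u) = cst (0 : R).
      by apply/funext => v; rewrite big_nil.
    exact: is_derive_cst.
  rewrite big_cons.
  have -> : (fun u => \sum_(a <- a :: s) F a u) = F a + (fun u => \sum_(a <- s) F a u).
    by apply/funext => v; rewrite big_cons.
  exact: is_deriveD.
rewrite /avg mulrC.
have -> : (fun u => (\sum_(z <- s) F z u) / (size s)%:R) =
  (size s)%:R^-1 *: (fun u => \sum_(z <- s) F z u).
  by apply/funext => v; rewrite mulrC.
exact: is_deriveZ.
Qed.

Lemma rule_val_le (gamma : R) (h : rule n) v x : 0 < gamma <= 1 ->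
  `|rule_val gamma h v x| <= gamma^-1.
Proof.
move=> /andP[g0 g1]; case: h => [W|] /=.
  have [b ->] := sparity_val_pm R W x.
  by rewrite normrM normr_pm mul1r ger0_norm// invr_ge0 ltW.
by rewrite normrN normr_pm invf_ge1.
Qed.

Variables (gamma eta tau : R) (T S m S0 : nat) (D : distr R n).
Hypotheses (g01 : 0 < gamma <= 1) (eta0 : 0 < eta) (eta_g : eta <= gamma ^+ 2).
Let pr := Params eta 1 tau T S m S0.

Let g0 : 0 < gamma. Proof. by case/andP: g01. Qed.
Let g1 : gamma <= 1. Proof. by case/andP: g01. Qed.

(** Since [|w| <= 1 / gamma], the condition [eta <= gamma^2] gives both [eta * w^2 <= 1] and
    [eta * |w| <= 1]. *)
Lemma rule_relabel_bounds (h : rule n) v v' x y u : 0 <= u <= eta ->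
  0 <= relabel_prob eta 1 v (rule_val gamma h v' x) y u <= 1.
Proof.
have := rule_val_le h v' x g01; set w := rule_val _ _ _ _ => wg.
have ew : eta * `|w| <= 1.
  apply: le_trans (_ : gamma ^+ 2 * gamma^-1 <= _); first by apply: ler_pM => //; exact: ltW.
  by rewrite expr2 mulfK ?gt_eqF.
have ew2 : eta * w ^+ 2 <= 1.
  apply: le_trans (_ : gamma ^+ 2 * gamma^-1 ^+ 2 <= _); last first.
    by rewrite exprVn mulfV// expf_neq0// gt_eqF.
  rewrite -(real_normK (num_real w)); apply: ler_pM; rewrite ?sqr_ge0 ?(ltW eta0)//.
  by rewrite lerXn2r ?nnegrE ?invr_ge0 ?(ltW g0).
exact: relabel_prob_bounds.
Qed.

Variables (hs : seq (rule n)) (h : rule n) (prev : prog R n (example n)).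
Variable (data : seq (example n)).

Let v (x : cube n) : R := ensemble gamma eta hs x.
Let w (x : cube n) : R := rule_val gamma h (v x) x.
Let p (z : example n) (u : R) : R := relabel_prob eta 1 (v z.1) (w z.1) z.2 u.

Lemma ensemble_rcons x : ensemble gamma eta (rcons hs h) x = v x + eta * w x.
Proof. by rewrite /ensemble -cats1 foldl_cat. Qed.

Definition relabel (u : R) : prog R n (example n) :=
  let! z := Defs.pick data in
  let! v := ensembleM gamma eta hs z.1 in
  let! w := ruleM gamma h v z.1 in
  let! p := step (relabel_prob eta 1 v w z.2 u) in
  Coin p (fun y => Ret (z.1, y)).

Lemma expect_relabel (f : example n -> R) u : expect D f (relabel u) =
  avg data (fun z => p z u * f (z.1, true) + (1 - p z u) * f (z.1, false)).
Proof.
rewrite expect_bind expect_pick; congr (_ / _); apply: eq_bigr => z _.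
rewrite (expect_computes_bind _ _ _ (computes_ensembleM _ _ _ _)).
by rewrite (expect_computes_bind _ _ _ (computes_ruleM _ _ _ _)).
Qed.

Lemma relabel_continuous z : continuous (p z).
Proof.
rewrite /p /relabel_prob derive1_phi derive2_phi => u.
apply: cvgB; first exact: cvg_cst.
apply: cvgM; last exact: cvg_cst.
apply: cvgD; first exact: cvg_cst.
apply: cvgM; last exact: cvg_cst.
apply: cvgM; first exact: cvg_cst.
apply: continuous_cvg; first exact: ddphi_continuous.
apply: cvgM; first exact: cvg_cst.
apply: cvgD; first exact: cvg_cst.
by apply: cvgM; last exact: cvg_cst.
Qed.

Lemma relabel_lawful u : (0 < size data)%N -> 0 <= u <= eta ->
  lawful D (fun=> True) (relabel u).
Proof.
move=> s0 ue; apply: (lawful_bind (I := fun=> True)); first exact: lawful_pick.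
move=> z _.
apply: (lawful_bind (lawful_computes (J := fun v' => v' = v z.1) D
  (computes_ensembleM _ _ _ _) _)) => // _ ->.
apply: (lawful_bind (lawful_computes (J := fun w' => w' = w z.1) D
  (computes_ruleM _ _ _ _) _)) => // _ ->.
apply: lawful_tick; apply: lawful_coin; first exact: rule_relabel_bounds.
by move=> b; exact: lawful_ret.
Qed.

Lemma round_sampler_lawful : (0 < size data)%N ->
  lawful D (fun=> True) (round_sampler gamma pr (Some (hs, h, prev)) data).
Proof.
move=> s0; apply: lawful_coin1; apply: lawful_unif => //.
  move=> f.
  have -> : (fun u => expect D f (relabel u)) = (fun u => avg data (fun z =>
     p z u * f (z.1, true) + (1 - p z u) * f (z.1, false))).
    by apply/funext => u; rewrite expect_relabel.
  apply: (@continuous_avg _ data (fun z u =>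
    p z u * f (z.1, true) + (1 - p z u) * f (z.1, false))) => z u.
  apply: cvgD; (apply: cvgM; last exact: cvg_cst); first exact: relabel_continuous.
  by apply: cvgB; [exact: cvg_cst|exact: relabel_continuous].
by move=> u ue; exact: relabel_lawful.
Qed.

(* Averaging over [u] integrates [ddphi] along the last step, so the new labels
   have the mean prescribed by the derivative of the potential at the current
   ensemble. *)
Lemma expect_round_sampler (X : cube n -> R) :
  expect D (fun z => pm z.2 * X z.1) (round_sampler gamma pr (Some (hs, h, prev)) data) =
  - (1 + eta)^-1 * avg data (fun z =>
      dphi (pm z.2 * ensemble gamma eta (rcons hs h) z.1) * (pm z.2 * X z.1)).
Proof.
have e1 : eta + 1 != 0 by rewrite gt_eqF// addr_gt0.
rewrite (_ : expect _ _ _ = eta^-1 * \int[lebesgue_measure]_(u in `[0, eta])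
  expect D (fun z => pm z.2 * X z.1) (relabel u)); last first.
  transitivity (1 * (eta^-1 * \int[lebesgue_measure]_(u in `[0, eta])
    expect D (fun z => pm z.2 * X z.1) (relabel u))
    + (1 - 1) * expect D (fun z => pm z.2 * X z.1) prev); first by [].
  by rewrite subrr mul0r addr0 mul1r.
pose f z u := - X z.1 / (1 + eta) * (dphi (pm z.2 * v z.1) * pm z.2
  + eta * ddphi (pm z.2 * (v z.1 + u * w z.1)) * w z.1).
(* [f z] is the conditional mean of the new label times [X], and [F z] is an antiderivative of it in
   [u]; differentiating [dphi] along the step produces a factor [pm z.2], which squares to 1. *)
pose F z u := - X z.1 / (1 + eta) * (dphi (pm z.2 * v z.1) * pm z.2 * u
  + eta * pm z.2 * dphi (pm z.2 * (v z.1 + u * w z.1))).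
have dF z (u : R) : is_derive u 1 (F z) (f z u).
  pose q (u : R) : R := pm z.2 * (v z.1 + u * w z.1).
  have dq : is_derive u 1 q (pm z.2 * w z.1).
    by apply: is_derive_eq; rewrite /GRing.scale/=; ring.
  have d1 : is_derive u 1 (fun u => dphi (q u)) (ddphi (q u) * (pm z.2 * w z.1)).
    have d2 : is_derive (q u) 1 dphi (ddphi (q u)) by exact: is_derive_dphi.
    exact: (is_derive1_comp d2 dq).
  have d3 : is_derive u 1 (fun u : R => dphi (pm z.2 * v z.1) * pm z.2 * u)
      (dphi (pm z.2 * v z.1) * pm z.2).
    by apply: is_derive_eq; rewrite /GRing.scale/=; ring.
  have := is_deriveZ (- X z.1 / (1 + eta)) (is_deriveD d3 (is_deriveZ (eta * pm z.2) d1)).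
  move=> d4; apply: (is_derive_eq d4); rewrite /f /GRing.scale/= -/(q u).
  have := sqr_pm R z.2; set y := pm z.2 => yy.
  congr (_ * (_ + _)).
  by transitivity (eta * ddphi (q u) * w z.1 * (y * y)); [ring|rewrite yy mulr1].
have cf z : continuous (f z).
  have -> : f z = fun u => (2 * p z u - 1) * X z.1.
    apply/funext => u; rewrite /f /p /relabel_prob derive1_phi derive2_phi mul1r.
    by field.
  move=> u; apply: cvgM; last exact: cvg_cst.
  apply: cvgB; last exact: cvg_cst.
  by apply: cvgM; [exact: cvg_cst|exact: relabel_continuous].
have ftc : \int[lebesgue_measure]_(u in `[0, eta]) avg data (f^~ u) =
    avg data (F^~ eta) - avg data (F^~ 0).
  apply: (@Rintegral_FTC _ (fun u => avg data (F^~ u))) => //.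
  - by move=> u; apply: (@is_derive_avg _ data F f) => z; exact: dF.
  - exact: (@continuous_avg _ data f).
rewrite (_ : Rintegral _ _ _ = avg data (F^~ eta) - avg data (F^~ 0)); last first.
  rewrite -ftc; apply: eq_Rintegral => u _; rewrite expect_relabel.
  congr (_ / _); apply: eq_bigr => z _.
  rewrite /f /p /relabel_prob derive1_phi derive2_phi mul1r /=.
  by rewrite /pm; field; rewrite addrC.
rewrite /avg -mulrBl mulrA -sumrB mulr_sumr mulrA mulr_sumr; congr (_ / _).
apply: eq_bigr => z _.
(* The value of [F z] at 0 cancels the term of [F z eta] that holds the old derivative: with mixing
   parameter 1 both have weight [eta]. Only the derivative at the updated ensemble survives. *)
rewrite /F ensemble_rcons mul0r addr0 mulr0 add0r.
by field; rewrite addrC e1 gt_eqF.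
Qed.

End Sampler.

(** * Fourier analysis on the cube *)


Definition flip (n : nat) (B : pred 'I_n) (x : cube n) : cube n :=
  [ffun i => x i (+) B i].

Lemma flipK (n : nat) (B : pred 'I_n) : involutive (flip B).
Proof. by move=> x; apply/ffunP => i; rewrite !ffunE addbK. Qed.

Section Fourier.
Variables (R : realType) (n : nat).
Implicit Types (A B : {set 'I_n}) (x y : cube n) (f : cube n -> R).

Lemma card_cube : #|cube n| = (2 ^ n)%N.
Proof. by rewrite card_ffun card_bool card_ord. Qed.

Definition mean f : R := (2 ^+ n)^-1 * \sum_x f x.

Lemma eq_mean f g : f =1 g -> mean f = mean g.
Proof. by move=> fg; congr (_ * _); apply: eq_bigr => x _; exact: fg. Qed.

Lemma pow2_gt0 : 0 < 2 ^+ n :> R. Proof. exact: exprn_gt0. Qed.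

Lemma mean_cst c : mean (fun=> c) = c.
Proof.
by rewrite /mean sumr_const card_cube -[c *+ _]mulr_natl natrX mulKf// gt_eqF// pow2_gt0.
Qed.

Lemma mean_le f g : (forall x, f x <= g x) -> mean f <= mean g.
Proof.
move=> fg; apply: ler_wpM2l; first by rewrite invr_ge0 ltW// pow2_gt0.
exact: ler_sum.
Qed.

Lemma meanD f g : mean (fun x => f x + g x) = mean f + mean g.
Proof. by rewrite /mean big_split mulrDr. Qed.

Lemma meanB f g : mean (fun x => f x - g x) = mean f - mean g.
Proof. by rewrite /mean sumrB mulrBr. Qed.

Lemma meanZ c f : mean (fun x => c * f x) = c * mean f.
Proof. by rewrite /mean -mulr_sumr mulrCA. Qed.

Lemma mean_sum (I : finType) (P : pred I) (F : I -> cube n -> R) :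
  mean (fun x => \sum_(i | P i) F i x) = \sum_(i | P i) mean (F i).
Proof. by rewrite /mean exchange_big mulr_sumr. Qed.

Lemma mean_flip (B : pred 'I_n) f : mean (fun x => f (flip B x)) = mean f.
Proof.
by rewrite /mean [in RHS](reindex_inj (inv_inj (@flipK n B))).
Qed.

Definition chi A x : R := \prod_(i in A) pm (x i).

(** This is -1 raised to the number of elements of [A] that lie in [B]. *)
Definition block_sign A (B : pred 'I_n) : R := \prod_(i in A) (if B i then -1 else 1).

Lemma pm_addb (a b : bool) : pm (a (+) b) = pm a * (if b then -1 else 1) :> R.
Proof. by case: a; case: b; rewrite /pm /= ?mulrNN ?mulr1 ?mul1r ?opprK. Qed.

Lemma chi_flip A (B : pred 'I_n) x : chi A (flip B x) = block_sign A B * chi A x.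
Proof.
rewrite /chi /block_sign -big_split; apply: eq_bigr => i _ /=.
by rewrite ffunE pm_addb mulrC.
Qed.

Lemma block_sign_set1 A i : block_sign A (pred1 i) = if i \in A then -1 else 1.
Proof.
rewrite /block_sign; case: ifPn => iA.
  rewrite (bigD1 i)//= eqxx big1 ?mulr1// => j /andP[_ /negbTE ji].
  by rewrite ji.
by rewrite big1// => j jA /=; have [ji|//] := eqVneq j i; rewrite -ji jA in iA.
Qed.

Lemma chi_sqr A x : chi A x * chi A x = 1.
Proof. by rewrite /chi -big_split big1// => i _ /=; rewrite sqr_pm. Qed.

(** If [A] and [B] differ at [i], flipping coordinate [i] preserves the mean but negates the
    product. *)
Lemma mean_chi A B : mean (fun x => chi A x * chi B x) = (A == B)%:R.
Proof.
have [->|AB] := eqVneq A B.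
  by rewrite -[RHS](mean_cst 1); congr (_ * _); apply: eq_bigr => x _; rewrite chi_sqr.
have [i iAB] : exists i, (i \in A) != (i \in B).
  by apply/existsP; rewrite -negb_forall; apply: contra AB => /forallP h;
     apply/eqP/setP => i; apply/eqP.
suff : mean (fun x => chi A x * chi B x) = - mean (fun x => chi A x * chi B x) by rewrite mulr0n; lra.
rewrite -[LHS](mean_flip (pred1 i)) -mulN1r -meanZ; congr (_ * _).
apply: eq_bigr => x _; rewrite !chi_flip !block_sign_set1.
by case: (i \in A) iAB; case: (i \in B) => // _; ring.
Qed.

(** The sum over all subsets is the expansion of a product of factors [x_i y_i + 1], one of which
    vanishes as soon as [x] and [y] differ. *)
Lemma sum_chi x y : \sum_A chi A x * chi A y = if x == y then 2 ^+ n else 0.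
Proof.
have -> : \sum_A chi A x * chi A y = \prod_(i < n) (pm (x i) * pm (y i) + 1).
  rewrite bigA_distr; apply: eq_bigr => A _.
  by rewrite /chi -big_split /= [LHS]big_mkcond.
have [->|xy] := eqVneq x y.
  under eq_bigr do rewrite sqr_pm.
  by rewrite prodr_const card_ord.
have [i ixy] : exists i, x i != y i.
  by apply/existsP; rewrite -negb_forall; apply: contra xy => /forallP h;
     apply/eqP/ffunP => i; apply/eqP.
rewrite (bigD1 i)//=; move: ixy; case: (x i); case: (y i) => // _.
  by rewrite /pm mul1r addNr mul0r.
by rewrite /pm mulr1 addNr mul0r.
Qed.

Definition coef f A : R := mean (fun x => f x * chi A x).

Lemma fourier_inversion f x : f x = \sum_A coef f A * chi A x.
Proof.
rewrite /coef /mean.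
under eq_bigr do rewrite -mulrA mulr_suml.
rewrite -mulr_sumr exchange_big /= (bigD1 x)//= [X in _ * (_ + X)]big1 ?addr0.
  under eq_bigr do rewrite -mulrA.
  by rewrite -mulr_sumr sum_chi eqxx mulrCA mulVf ?mulr1// gt_eqF// pow2_gt0.
move=> y /negbTE yx; under eq_bigr do rewrite -mulrA.
by rewrite -mulr_sumr sum_chi yx mulr0.
Qed.

Lemma mean_noise f (B : pred 'I_n) :
  mean (fun x => f x * f (flip B x)) = \sum_A coef f A ^+ 2 * block_sign A B.
Proof.
transitivity (mean (fun x => \sum_A coef f A * block_sign A B * (f x * chi A x))).
  congr (_ * _); apply: eq_bigr => x _; rewrite [X in _ * X]fourier_inversion mulr_sumr.
  by apply: eq_bigr => A _; rewrite chi_flip; ring.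
by rewrite mean_sum; apply: eq_bigr => A _; rewrite meanZ -/(coef f A); ring.
Qed.

Lemma parseval f : \sum_A coef f A ^+ 2 = mean (fun x => f x ^+ 2).
Proof.
transitivity (\sum_A coef f A ^+ 2 * block_sign A xpred0).
  by apply: eq_bigr => A _; rewrite /block_sign big1 ?mulr1.
rewrite -mean_noise; congr (_ * _); apply: eq_bigr => x _.
by rewrite expr2; congr (_ * f _); apply/ffunP => i; rewrite !ffunE addbF.
Qed.

Lemma mean_partial (P : pred {set 'I_n}) f :
  mean (fun x => (\sum_(A | P A) coef f A * chi A x) ^+ 2) = \sum_(A | P A) coef f A ^+ 2.
Proof.
transitivity (mean (fun x => \sum_(A | P A) coef f A * \sum_(B | P B) coef f B *
    (chi A x * chi B x))).
  congr (_ * _); apply: eq_bigr => x _; rewrite expr2 mulr_suml.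
  apply: eq_bigr => A _; rewrite -mulrA mulr_sumr; congr (_ * _).
  by apply: eq_bigr => B _; rewrite mulrCA.
rewrite mean_sum; apply: eq_bigr => A PA; rewrite meanZ mean_sum (bigD1 A)//=.
rewrite meanZ mean_chi eqxx big1; first by rewrite addr0 mulr1.
by move=> B /andP[_ /negbTE BA]; rewrite meanZ mean_chi eq_sym BA mulr0.
Qed.

End Fourier.

(** * Noise sensitivity of halfspaces *)


Lemma bernoulli_le (R : realType) (x : R) k : 0 <= x -> 1 + k%:R * x <= (1 + x) ^+ k.
Proof.
move=> x0; elim: k => [|k IH]; first by rewrite mul0r addr0 expr0.
rewrite exprS; apply: le_trans (ler_wpM2l _ IH); last lra.
rewrite -natr1; have := mulr_ge0 (mulr_ge0 (ler0n R k) x0) x0; lra.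
Qed.

Section Halfspace.
Variables (R : realType) (n m : nat).
Hypothesis m2 : (1 < m)%N.

Let r : R := Num.sqrt m%:R.

Lemma sqrt_block_gt0 : 0 < r.
Proof. by rewrite sqrtr_gt0 ltr0n (ltn_trans _ m2). Qed.

Lemma sqr_sqrt_block : r ^+ 2 = m%:R.
Proof. by rewrite sqr_sqrtr. Qed.

Lemma mean_square_signed_sum (s : 'I_m -> bool) :
  mean (fun z : cube m => (\sum_j pm (s j) * pm (z j)) ^+ 2) = m%:R :> R.
Proof.
have chi1 (z : cube m) j : chi R [set j] z = pm (z j) by rewrite /chi big_set1.
transitivity (mean (fun z : cube m => \sum_j \sum_k (pm (s j) * pm (s k)) *
    (chi R [set j] z * chi R [set k] z))).
  congr (_ * _); apply: eq_bigr => z _; rewrite expr2 mulr_suml.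
  apply: eq_bigr => j _; rewrite mulr_sumr; apply: eq_bigr => k _.
  by rewrite !chi1; ring.
rewrite mean_sum -[X in _ = X%:R](card_ord m) -sum1_card natr_sum; apply: eq_bigr => j _.
rewrite mean_sum (bigD1 j)//= meanZ mean_chi eqxx sqr_pm mulr1 big1 ?addr0// => k kj.
by rewrite meanZ mean_chi (inj_eq set1_inj) eq_sym (negbTE kj) mulr0.
Qed.

(* A linear threshold function is unate, so its influences are, up to sign, its
   degree-1 coefficients, and Cauchy-Schwarz bounds their sum. *)
Lemma threshold_total_influence (a : 'I_m -> R) (theta : R)
    (g := fun z : cube m => pm (0 <= \sum_j a j * pm (z j) - theta) : R) :
  \sum_j mean (fun z => 1 - g z * g (flip (pred1 j) z)) <= 2 * r.
Proof.
pose s j := 0 <= a j.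
have unate j z : 1 - g z * g (flip (pred1 j) z) <=
    pm (s j) * pm (z j) * (g z - g (flip (pred1 j) z)).
  rewrite /g.
  have -> : \sum_k a k * pm (flip (pred1 j) z k) - theta =
      \sum_k a k * pm (z k) - theta - 2 * (a j * pm (z j)) :> R.
    rewrite (bigD1 j)//= [in RHS](bigD1 j)//= ffunE /= eqxx pm_addb.
    rewrite (eq_bigr (fun k => a k * pm (z k))); first ring.
    by move=> k /negbTE kj; rewrite ffunE /= kj addbF.
  move: (\sum_k _ - theta) => L; rewrite /s.
  case: (z j); rewrite /pm; case: (leP 0 (a j)) => aj; case: (leP 0 L) => L0;
    case: (leP 0 (L - _)) => L1; lra.
have anti j : mean (fun z => pm (s j) * pm (z j) * g (flip (pred1 j) z)) =
    - mean (fun z => pm (s j) * pm (z j) * g z) :> R.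
  rewrite -[LHS](mean_flip (pred1 j)) -mulN1r -meanZ; congr (_ * _).
  by apply: eq_bigr => z _; rewrite flipK ffunE /= eqxx pm_addb; ring.
apply: le_trans (_ : \sum_j 2 * mean (fun z => pm (s j) * pm (z j) * g z) <= _).
  apply: ler_sum => j _; apply: le_trans (mean_le (unate j)) _.
  under eq_mean do rewrite mulrBr.
  by rewrite meanB anti; lra.
rewrite -mulr_sumr ler_pM2l//.
rewrite -mean_sum.
have r0 := sqrt_block_gt0.
(* Cauchy-Schwarz in the form [|M| <= M^2 / (2 r) + r / 2]; the choice [r^2 = m], the mean of [M^2],
   is optimal. *)
apply: le_trans (mean_le (g := fun z => (2 * r)^-1 *
   (\sum_j pm (s j) * pm (z j)) ^+ 2 + r / 2) _) _.
  move=> z; rewrite -mulr_suml; set M := \sum_j _.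
  have gg : `|g z| = 1 by exact: normr_pm.
  apply: le_trans (ler_norm _) _; rewrite normrM gg mulr1.
  rewrite -(real_normK (num_real M)) -(ler_pM2l (_ : 0 < 2 * r)); last lra.
  rewrite mulrDr mulrA mulfV ?mul1r; last by rewrite gt_eqF//; lra.
  by have := sqr_ge0 (`|M| - r); rewrite sqrrB; lra.
rewrite meanD mean_cst meanZ mean_square_signed_sum -sqr_sqrt_block.
rewrite le_eqVlt; apply/orP; left; apply/eqP; field; exact: lt0r_neq0.
Qed.

Definition block (pi : {ffun 'I_n -> 'I_m}) (j : 'I_m) : pred 'I_n :=
  fun i => pi i == j.

(* Peres' argument: with [x] fixed, flipping whole blocks of a partition of the
   coordinates makes the halfspace a threshold function of [m] bits. *)
Lemma halfspace_block_influence (w : 'rV[R]_n) theta (pi : {ffun 'I_n -> 'I_m})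
    (f := fun x : cube n => pm (halfspace w theta x) : R) :
  \sum_j mean (fun x => 1 - f x * f (flip (block pi j) x)) <= 2 * r.
Proof.
pose mix (x : cube n) (z : cube m) : cube n := flip (fun i => z (pi i)) x.
have fix_x x : \sum_j mean (fun z => 1 - f (mix x z) * f (flip (block pi j) (mix x z)))
    <= 2 * r.
  (* The minus sign is a convention: [true] stands for +1, yet it is the value of [z j] that flips
     block [j]. *)
  pose a j : R := \sum_(i | pi i == j) w 0 i * - pm (x i).
  have fE z : f (mix x z) = pm (0 <= \sum_j a j * pm (z j) - theta).
    rewrite /f /halfspace; congr (pm (0 <= _ - theta)).
    rewrite (partition_big (fun i => pi i) xpredT)//=; apply: eq_bigr => j _.
    rewrite /a mulr_suml; apply: eq_bigr => i /eqP ij.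
    by rewrite ffunE pm_addb ij; case: (z j); rewrite /pm; ring.
  have mixflip j z : flip (block pi j) (mix x z) = mix x (flip (pred1 j) z).
    by apply/ffunP => i; rewrite !ffunE addbA.
  have := threshold_total_influence a theta => /=.
  under eq_bigr do under eq_mean do rewrite -!fE -mixflip.
  exact.
rewrite -(@mean_cst R n (2 * r)).
apply: le_trans (mean_le fix_x).
rewrite mean_sum; apply: ler_sum => j _.
rewrite le_eqVlt; apply/orP; left; apply/eqP.
(* For each fixed [z] the map [mix^~ z] permutes the cube, so averaging over [z] as well changes
   nothing; the two means are then exchanged. *)
transitivity (mean (fun z : cube m => mean (fun x =>
    1 - f (mix x z) * f (flip (block pi j) (mix x z))))).
  transitivity (mean (fun z : cube m => mean (fun x =>
      1 - f x * f (flip (block pi j) x)))); first by rewrite mean_cst.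
  congr (_ * _); apply: eq_bigr => z _.
  by rewrite -[LHS](mean_flip (fun i => z (pi i))).
by rewrite /mean -!mulr_sumr exchange_big /= mulrCA.
Qed.

(** Under a uniformly random assignment of coordinates to blocks, each element of [A] falls into
    block [j] independently with probability [1 / m] and contributes a mean sign [1 - 2 / m]; [m^n]
    counts the assignments. *)
Lemma sum_block_sign (A : {set 'I_n}) (j : 'I_m) :
  \sum_(pi : {ffun 'I_n -> 'I_m}) block_sign R A (block pi j) =
  m%:R ^+ n * (1 - 2 / m%:R) ^+ #|A|.
Proof.
have m0 : m%:R != 0 :> R by rewrite pnatr_eq0; case: (m) m2.
pose F (i : 'I_n) (k : 'I_m) : R := if i \in A then (if k == j then -1 else 1) else 1.
transitivity (\sum_(pi : {ffun 'I_n -> 'I_m}) \prod_i F i (pi i)).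
  by apply: eq_bigr => pi _; rewrite /block_sign big_mkcond.
rewrite -bigA_distr_bigA /=.
transitivity (\prod_(i < n) (m%:R * (if i \in A then 1 - 2 / m%:R else 1)) : R).
  apply: eq_bigr => i _; rewrite /F; case: (i \in A).
    rewrite (bigD1 j)//= eqxx (eq_bigr (fun=> 1)); last by move=> k /negbTE ->.
    rewrite sumr_const; have := cardC1 j; rewrite card_ord => ->.
    have E : (m.-1)%:R = m%:R - 1 :> R by rewrite -subn1 natrB// ltnW.
    by rewrite E; field.
  by rewrite sumr_const card_ord mulr1.
rewrite big_split /= prodr_const card_ord; congr (_ * _).
by rewrite -big_mkcond /= prodr_const.
Qed.

(** Averaging the influence bound over all partitions makes the [m] blocks contribute equally, so
    each of them gets at most [2 r / m = 2 / r]. *)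
Lemma halfspace_noise (w : 'rV[R]_n) theta
    (f := fun x : cube n => pm (halfspace w theta x) : R) :
  \sum_A coef f A ^+ 2 * (1 - (1 - 2 / m%:R) ^+ #|A|) <= 2 / r.
Proof.
have r0 := sqrt_block_gt0; have rr := sqr_sqrt_block.
have m0 : 0 < m%:R :> R by rewrite ltr0n (ltn_trans _ m2).
have one : \sum_A coef f A ^+ 2 = 1.
  rewrite parseval -[RHS](@mean_cst R n 1); congr (_ * _); apply: eq_bigr => x _.
  by rewrite expr2 sqr_pm.
have := ler_sum (index_enum _) (fun pi (_ : true) => halfspace_block_influence w theta pi).
rewrite [X in _ <= X]sumr_const card_ffun !card_ord exchange_big /=.
have -> : \sum_(j < m) \sum_(pi : {ffun 'I_n -> 'I_m})
     mean (fun x => 1 - f x * f (flip (block pi j) x)) =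
   \sum_(j < m) m%:R ^+ n * \sum_A coef f A ^+ 2 * (1 - (1 - 2 / m%:R) ^+ #|A|).
  apply: eq_bigr => j _.
  transitivity (\sum_(pi : {ffun 'I_n -> 'I_m}) \sum_A
      coef f A ^+ 2 * (1 - block_sign R A (block pi j))).
    apply: eq_bigr => pi _; rewrite meanB mean_cst mean_noise -[X in X - _]one -sumrB.
    by apply: eq_bigr => A _; rewrite mulrBr mulr1.
  rewrite exchange_big mulr_sumr /=; apply: eq_bigr => A _.
  rewrite -mulr_sumr sumrB sum_block_sign sumr_const card_ffun !card_ord natrX; ring.
rewrite sumr_const card_ord -[_ *+ m]mulr_natl -[_ *+ (m ^ n)]mulr_natl natrX.
set V := \sum_A _.
rewrite mulrCA ler_pM2l ?exprn_gt0// -rr => h.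
rewrite ler_pdivlMr// -(ler_pM2l r0); lra.
Qed.

(** Above degree [d >= m] the weight [1 - (1 - 2 / m)^#|A|] is at least 2/3, which turns [2 / r]
    into [3 / r]. *)
Lemma halfspace_tail (w : 'rV[R]_n) theta d
    (f := fun x : cube n => pm (halfspace w theta x) : R) : (m <= d)%N ->
  \sum_(A : {set 'I_n} | (d < #|A|)%N) coef f A ^+ 2 <= 3 / r.
Proof.
move=> md; have h := halfspace_noise w theta.
have m0 : 2 <= m%:R :> R by rewrite ler_nat.
pose q : R := 1 - 2 / m%:R.
have q0 : 0 <= q by rewrite subr_ge0 ler_pdivrMr; lra.
have q1 : q <= 1 by rewrite gerBl divr_ge0.
(* [(1 - 2 / m) (1 + 2 / m) <= 1], and Bernoulli's inequality bounds the [m]-th power of the second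
   factor below by 3. *)
have qm : q ^+ m <= 1 / 3.
  have b : 3 <= (1 + 2 / m%:R) ^+ m :> R.
    apply: le_trans (_ : 1 + m%:R * (2 / m%:R) <= _).
      by rewrite mulrC divfK ?gt_eqF//; lra.
    by apply: bernoulli_le; rewrite divr_ge0.
  have : q ^+ m * (1 + 2 / m%:R) ^+ m <= 1.
    rewrite -exprMn exprn_ile1//.
      by rewrite mulr_ge0// addr_ge0// divr_ge0.
    have -> : q * (1 + 2 / m%:R) = 1 - (2 / m%:R) ^+ 2 by rewrite /q; ring.
    by rewrite gerBl sqr_ge0.
  have := ler_wpM2l (exprn_ge0 m q0) b; lra.
have qA (A : {set 'I_n}) : (d < #|A|)%N -> q ^+ #|A| <= 1 / 3.
  move=> dA; apply: le_trans qm; apply: ler_wiXn2l => //.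
  exact: leq_trans md (ltnW dA).
have qA1 (A : {set 'I_n}) : q ^+ #|A| <= 1 by rewrite exprn_ile1.
have : \sum_(A : {set 'I_n} | (d < #|A|)%N) coef f A ^+ 2 * (2 / 3) <= 2 / r.
  apply: le_trans h.
  rewrite [leRHS](bigID (fun A : {set 'I_n} => (d < #|A|)%N)) /=.
  rewrite -[leLHS]addr0; apply: lerD.
    by apply: ler_sum => A dA; apply: ler_wpM2l; rewrite ?sqr_ge0//; have := qA _ dA; rewrite /q; lra.
  by apply: sumr_ge0 => A _; rewrite mulr_ge0 ?sqr_ge0// subr_ge0 qA1.
rewrite -mulr_suml; lra.
Qed.

End Halfspace.

(** * Low-degree parities as weak learners *)


Section Weak.
Variables (R : realType) (n : nat).

(** A set of at most [d] elements is encoded by its enumeration, padded with [None] to length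
    [d]. *)
Lemma card_small_sets_expn d :
  (#|[pred A : {set 'I_n} | #|A| <= d]| <= n.+1 ^ d)%N.
Proof.
pose code (A : {set 'I_n}) : {ffun 'I_d -> option 'I_n} :=
  [ffun k : 'I_d => nth None (map Some (enum A)) k].
pose decode (c : {ffun 'I_d -> option 'I_n}) := [set i | [exists k, c k == Some i]].
have codeK : {in [pred A : {set 'I_n} | (#|A| <= d)%N], cancel code decode}.
  move=> A; rewrite inE => Ad; apply/setP => i; rewrite inE.
  apply/existsP/idP => [[k]|iA].
    rewrite ffunE; have [ks|ks] := ltnP k (size (enum A)); last first.
      by rewrite nth_default // size_map.
    by rewrite (nth_map i)// => /eqP[<-]; rewrite -mem_enum mem_nth.
  have ie : i \in enum A by rewrite mem_enum.
  have kd : (index i (enum A) < d)%N.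
    by apply: leq_trans Ad; rewrite cardE index_mem.
  exists (Ordinal kd); rewrite ffunE /= (nth_map i) ?index_mem//.
  by rewrite nth_index.
rewrite -(card_in_imset (can_in_inj codeK)).
by apply: leq_trans (max_card _) _; rewrite card_ffun card_option !card_ord.
Qed.

(** For [n >= 2], [n + 1 <= n^2]; the factor 2 covers [n = 1], where there are two subsets but all
    powers of [n] are 1. *)
Lemma card_small_sets d : (0 < n)%N ->
  (#|[pred A : {set 'I_n} | #|A| <= d]| <= 2 * n ^ (2 * d))%N.
Proof.
move=> n0; have [n1|n2] := leqP n 1.
  have -> : n = 1%N by lia.
  rewrite exp1n muln1; apply: leq_trans (max_card _) _.
  by rewrite -cardsT -powersetT card_powerset cardsT card_ord.
apply: leq_trans (card_small_sets_expn d) _.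
apply: leq_trans (leq_pmull _ (isT : (0 < 2)%N)).
case: d => // d; rewrite expnM leq_exp2r //; nia.
Qed.

(** Cauchy-Schwarz over about [n^(2 d)] sets, as [|a| <= K a^2 / 2 + 1 / (2 K)] with [K = n^d];
    Parseval bounds the sum of squares by 1. *)
Lemma sum_abs_coef_le (f : cube n -> R) d : (0 < n)%N -> (forall x, `|f x| <= 1) ->
  \sum_(A : {set 'I_n} | (#|A| <= d)%N) `|coef f A| <= 2 * n%:R ^+ d.
Proof.
move=> n0 f1; set K := n%:R ^+ d.
have K0 : 0 < K by rewrite exprn_gt0// ltr0n.
have par : \sum_(A : {set 'I_n} | (#|A| <= d)%N) coef f A ^+ 2 <= 1.
  apply: le_trans (_ : \sum_A coef f A ^+ 2 <= _).
    rewrite [leRHS](bigID (fun A : {set 'I_n} => (#|A| <= d)%N)) /= lerDl.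
    by apply: sumr_ge0 => A _; exact: sqr_ge0.
  rewrite parseval -[leRHS](@mean_cst R n 1); apply: mean_le => x.
  by rewrite -(real_normK (num_real _)) exprn_ile1.
have card : (\sum_(A : {set 'I_n} | (#|A| <= d)%N) 1 : R) <= 2 * K ^+ 2.
  rewrite sumr_const (_ : 2 * K ^+ 2 = (2 * n ^ (2 * d))%:R); last first.
    by rewrite natrM natrX /K -exprM mulnC.
  by rewrite ler_nat; exact: card_small_sets.
apply: le_trans (_ : \sum_(A : {set 'I_n} | (#|A| <= d)%N)
    ((K / 2) * coef f A ^+ 2 + (2 * K)^-1 * 1) <= _).
  apply: ler_sum => A _; rewrite -(real_normK (num_real (coef f A))).
  rewrite -(ler_pM2l (_ : 0 < 2 * K)); last lra.
  rewrite mulr1 [leRHS]mulrDr mulfV; last by rewrite gt_eqF//; lra.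
  by have := sqr_ge0 (K * `|coef f A| - 1); rewrite sqrrB exprMn; lra.
rewrite big_split /= -!mulr_sumr.
apply: le_trans (_ : K / 2 * 1 + (2 * K)^-1 * (2 * K ^+ 2) <= _).
  apply: lerD; apply: ler_wpM2l => //; first lra.
  by rewrite invr_ge0; lra.
have -> : (2 * K)^-1 * (2 * K ^+ 2) = K by field; exact: lt0r_neq0.
lra.
Qed.

(* If a halfspace correlates with the weighted labels, then so does a parity of
   low degree: the low-degree part of the halfspace has small spectral norm, and
   its high-degree part is small in mean square. *)
Lemma halfspace_correlation_le (D : distr R n) (c : example n -> R)
    (w : 'rV[R]_n) theta (m d : nat) (rho kappa : R) :
  uniform_marginal D -> (0 < n)%N -> (1 < m <= d)%N -> 0 < kappa ->
  3 <= kappa ^+ 2 * Num.sqrt m%:R ->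
  (forall z, `|c z| <= 1) ->
  (forall A : {set 'I_n}, (#|A| <= d)%N -> `|\sum_z D z * (c z * chi R A z.1)| <= rho) ->
  \sum_z D z * (c z * pm (halfspace w theta z.1)) <= 2 * n%:R ^+ d * rho + kappa.
Proof.
move=> uD n0 /andP[m1 md] k0 km c1 rhoP.
pose f (x : cube n) : R := pm (halfspace w theta x).
pose g (x : cube n) := \sum_(A : {set 'I_n} | (d < #|A|)%N) coef f A * chi R A x.
have fE x : f x = \sum_(A : {set 'I_n} | (#|A| <= d)%N) coef f A * chi R A x + g x.
  rewrite [LHS]fourier_inversion (bigID (fun A : {set 'I_n} => (#|A| <= d)%N)) /=.
  by congr (_ + _); apply: eq_bigl => A; rewrite -ltnNge.
(* Uniformity of the marginal enters here: it turns an expectation under [D] into the mean for which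
   parities are orthonormal. *)
have marginal (h : cube n -> R) : \sum_z D z * h z.1 = mean h.
  transitivity (\sum_(x : cube n) \sum_(y : bool) D (x, y) * h x).
    by rewrite pair_bigA; apply: eq_bigr => -[].
  by rewrite /mean mulr_sumr; apply: eq_bigr => x _; rewrite -mulr_suml uD.
have rho0 : 0 <= rho by apply: le_trans (rhoP finset.set0 _); rewrite ?cards0.
have -> : \sum_z D z * (c z * pm (halfspace w theta z.1)) =
    \sum_(A : {set 'I_n} | (#|A| <= d)%N) coef f A * \sum_z D z * (c z * chi R A z.1) +
    \sum_z D z * (c z * g z.1).
  under [X in _ = X + _]eq_bigr do rewrite mulr_sumr.
  rewrite exchange_big -big_split /=; apply: eq_bigr => z _.
  rewrite -/(f z.1) fE !mulrDr; congr (_ + _).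
  by rewrite !mulr_sumr; apply: eq_bigr => A _; ring.
apply: lerD.
  apply: le_trans (_ : \sum_(A : {set 'I_n} | (#|A| <= d)%N) `|coef f A| * rho <= _).
    apply: ler_sum => A Ad; apply: le_trans (ler_norm _) _.
    by rewrite normrM; apply: ler_wpM2l => //; exact: rhoP.
  rewrite -mulr_suml ler_wpM2r// sum_abs_coef_le// => x.
  by rewrite normr_pm.
have D0 z : 0 <= D z := mass_ge0 D z.
apply: le_trans (_ : \sum_z D z * `|g z.1| <= _).
  apply: ler_sum => z _; apply: ler_wpM2l => //.
  by apply: le_trans (ler_norm _) _; rewrite normrM ler_piMl.
rewrite (marginal (fun x => `|g x|)).
(* The bound [|g| <= g^2 / (2 kappa) + kappa / 2] passes from mean square at most [kappa^2] to first
   moment at most [kappa]. *)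
apply: le_trans (mean_le (g := fun x => (2 * kappa)^-1 * g x ^+ 2 + kappa / 2) _) _.
  move=> x; rewrite -(real_normK (num_real (g x))) -(ler_pM2l (_ : 0 < 2 * kappa)); last lra.
  rewrite mulrDr mulrA mulfV ?mul1r; last by rewrite gt_eqF//; lra.
  by have := sqr_ge0 (`|g x| - kappa); rewrite sqrrB; lra.
rewrite meanD mean_cst meanZ mean_partial.
have s0 : 0 < Num.sqrt m%:R :> R by rewrite sqrtr_gt0 ltr0n ltnW.
have tail : \sum_(A : {set 'I_n} | (d < #|A|)%N) coef f A ^+ 2 <= kappa ^+ 2.
  have h := @halfspace_tail R n m m1 w theta d md; apply: le_trans h _.
  by rewrite ler_pdivrMr.
apply: le_trans (_ : (2 * kappa)^-1 * kappa ^+ 2 + kappa / 2 <= _).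
  by rewrite lerD2r; apply: ler_wpM2l tail; rewrite invr_ge0; lra.
rewrite le_eqVlt; apply/orP; left; apply/eqP; field; exact: lt0r_neq0.
Qed.

End Weak.

(** * Running time *)


(** [runs_within] with a postcondition on the results, so that budgets compose through [bind]. *)
Fixpoint runs_to (R : realType) (n : nat) (A : Type) (P : prog R n A)
    (q t : nat) (I : A -> Prop) {struct P} : Prop :=
  match P, t with
  | Ret a, _ => I a
  | _, 0%N => False
  | Tick P', t'.+1 => runs_to P' q t' I
  | Example k, t'.+1 =>
      if q is q'.+1 then forall z, runs_to (k z) q' t' I else False
  | Coin p k, t'.+1 => 0 <= p <= 1 /\ forall b, runs_to (k b) q t' I
  | Unif a k, t'.+1 => 0 < a /\ forall u, 0 <= u <= a -> runs_to (k u) q t' I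
  | Defs.Pick N k, t'.+1 => (0 < N)%N /\ forall i, runs_to (k i) q t' I
  end.

Section RunsTo.
Variables (R : realType) (n : nat).

Lemma runs_to_within (A : Type) (P : prog R n A) q t I :
  runs_to P q t I -> runs_within P q t.
Proof.
elim: P q t => [a|P IH|k IH|p k IH|a k IH|N k IH] q [|t] //=; first exact: IH.
- by case: q => // q h z; apply: IH (h z).
- by move=> [p01 h]; split=> // b; apply: IH (h b).
- by move=> [a0 h]; split=> // u ua; apply: IH (h u ua).
- by move=> [N0 h]; split=> // i; apply: IH (h i).
Qed.

Lemma runs_to_le (A : Type) (P : prog R n A) q q' t t' (I J : A -> Prop) :
  (q <= q')%N -> (t <= t')%N -> (forall a, I a -> J a) ->
  runs_to P q t I -> runs_to P q' t' J.
Proof.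
move=> + + IJ.
elim: P q q' t t' => [a|P IH|k IH|p k IH|a k IH|N k IH] q q' [|t] [|t'] //=;
  try by move=> *; exact: IJ.
- by move=> qq; rewrite ltnS => tt; apply: IH.
- by case: q q' => // q [|q'] //; rewrite !ltnS => qq tt h z; apply: IH (h z).
- by move=> qq; rewrite ltnS => tt [p01 h]; split=> // b; apply: IH (h b).
- by move=> qq; rewrite ltnS => tt [a0 h]; split=> // u ua; apply: IH (h u ua).
- by move=> qq; rewrite ltnS => tt [N0 h]; split=> // i; apply: IH (h i).
Qed.

Lemma runs_to_bind (A B : Type) (P : prog R n A) (f : A -> prog R n B)
    q1 t1 q2 t2 (I : A -> Prop) (J : B -> Prop) :
  runs_to P q1 t1 I -> (forall a, I a -> runs_to (f a) q2 t2 J) ->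
  runs_to (bind P f) (q1 + q2) (t1 + t2) J.
Proof.
move=> + fJ.
elim: P q1 t1 => [a|P IH|k IH|p k IH|a k IH|N k IH] q1 t1.
- move=> /= /fJ; apply: runs_to_le => //; exact: leq_addl.
- by case: t1 => //= t1; exact: IH.
- by case: t1 => //= t1; case: q1 => //= q1 h z; exact: IH.
- by case: t1 => //= t1 [p01 h]; split=> // b; exact: IH.
- by case: t1 => //= t1 [a0 h]; split=> // u ua; apply: IH; exact: h.
- by case: t1 => //= t1 [N0 h]; split=> // i; exact: IH.
Qed.

Lemma runs_to_computes (A : Type) (P : prog R n A) t v (J : A -> Prop) :
  computes P t v -> J v -> runs_to P 0 t J.
Proof.
move=> [k kt ->] Jv; elim: k t kt => [|k IH] [|t] //= kt; exact: IH.
Qed.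

Lemma runs_to_iterM (A : Type) (J : nat -> A -> Prop) (f : A -> prog R n A) k a q t :
  J 0%N a -> (forall j a, (j < k)%N -> J j a -> runs_to (f a) q t (J j.+1)) ->
  runs_to (Defs.iterM k f a) (k * q) (k * t.+1) (J k).
Proof.
move=> J0 Jf.
suff main l i b : (i + l = k)%N -> J i b ->
    runs_to (Defs.iterM l f b) (l * q) (l * t.+1) (J k) by exact: (main k 0%N).
elim: l i b => [|l IH] i b il Jb; first by rewrite addn0 in il; rewrite /= -il.
rewrite mulSn [in X in runs_to _ _ X]mulSn addSn /=.
apply: runs_to_bind (Jf i b _ Jb) _; first by rewrite -il addnS ltnS leq_addr.
by move=> c; apply: IH; rewrite addSnnS.
Qed.

Lemma runs_to_sampleM (A : Type) (P : prog R n A) k q t :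
  runs_to P q t (fun=> True) ->
  runs_to (sampleM k P) (k * q) (k * t.+1) (fun s => size s = k).
Proof.
move=> sP; apply: (@runs_to_iterM _ (fun j (s : seq A) => size s = j)) => // j s _ sj.
rewrite -[q]addn0 -[t]addn0; apply: runs_to_bind sP _ => a _.
by rewrite /= size_rcons sj.
Qed.

Lemma runs_to_draw : runs_to (draw : prog R n (example n)) 1 n.+1 (fun=> True).
Proof.
suff main k : runs_to (iter k Tick (Example Ret) : prog R n (example n)) 1 k.+1
  (fun=> True) by exact: main.
by elim: k.
Qed.

Section Boost.
Variables (gamma eta tau : R) (T S m S0 d : nat).
Hypotheses (g01 : 0 < gamma <= 1) (eta0 : 0 < eta) (eta_g : eta <= gamma ^+ 2).
Hypotheses (S_gt0 : (0 < S)%N).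
Let pr := Params eta 1 tau T S m S0.

Definition relabel_time := (T * (2 * n).+3 + (2 * n) + 6)%N.
Definition erm_time :=
  ((m * (2 * n).+2).+1 + size (sparities n d) * (m * (2 * n).+2).+3)%N.
Definition round_time :=
  (S * n.+2 + (m * (relabel_time + T).+1 + (erm_time + (m * (2 * n).+2 + 1))))%N.
Definition score_time := (S0 * (T * (2 * n).+3).+2 + 1)%N.
Definition boost_time :=
  (T * round_time.+1 + (S0 * n.+2 + (score_time + T * score_time.+2)))%N.

(** Time is charged on every path, even one of probability 0: each sampler contains the previous one
    under its coin, so its budget grows by one unit per round. *)
Definition state_ok j (st : state R n) : Prop :=
  size (rules_of st) = j /\
  (if st is Some (_, _, prev) then runs_to prev 0 (relabel_time + j) (fun=> True) else True).

Lemma runs_to_round_sampler j (st : state R n) (data : seq (example n)) :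
  (j < T)%N -> (0 < size data)%N -> state_ok j st ->
  runs_to (round_sampler gamma pr st data) 0 (relabel_time + j.+1) (fun=> True).
Proof.
case: st => [[[hs h] prev]|] /= jT s0 [sj ok]; last by rewrite /relabel_time addnS.
rewrite size_rcons in sj.
rewrite addnS; split; first by rewrite ler01 lexx.
case; last by [].
(* The budget is split in the order in which the program consumes it; the last summand is slack. *)
have -> : (relabel_time + j)%N = (1 + (1 + (size hs * (2 * n).+3 + ((2 * n).+1 + 2 +
   (relabel_time + j - (size hs * (2 * n).+3 + (2 * n) + 5))))))%N.
  have : (size hs * (2 * n).+3 <= T * (2 * n).+3)%N by rewrite leq_mul2r; lia.
  rewrite /relabel_time; lia.
split=> // u ue.
split=> // i; set z := tnth _ i; rewrite add0n.
apply: (@runs_to_bind _ _ _ _ 0 _ 0 _ (fun v => v = ensemble gamma eta hs z.1)).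
  exact: runs_to_computes (computes_ensembleM _ _ _ _) _.
move=> _ ->; rewrite -addnA.
apply: (@runs_to_bind _ _ _ _ 0 _ 0 _
  (fun w => w = rule_val gamma h (ensemble gamma eta hs z.1) z.1)).
  exact: runs_to_computes (computes_ruleM _ _ _ _) _.
move=> _ ->; split; last by [].
exact: rule_relabel_bounds.
Qed.

Lemma runs_to_round tieW j (st : state R n) : (j < T)%N -> state_ok j st ->
  runs_to (round d gamma pr tieW st) S round_time (state_ok j.+1).
Proof.
move=> jT ok; rewrite -[X in runs_to _ X]addn0.
apply: (@runs_to_bind _ _ _ _ S _ 0 _ (fun data => size data = S)).
  by rewrite -[X in runs_to _ X](muln1 S); apply: runs_to_sampleM; exact: runs_to_draw.
move=> data sdata.
have s0 : (0 < size data)%N by rewrite sdata.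
have sam := runs_to_round_sampler jT s0 ok.
apply: (@runs_to_bind _ _ _ _ 0 _ 0 _ (fun data => size data = m)).
  rewrite -[X in runs_to _ X](muln0 m); apply: runs_to_sampleM.
  by apply: runs_to_le sam => //; rewrite leq_add2l.
move=> redata sred.
have [W [cW _ _]] := computes_erm R d tieW redata.
apply: (@runs_to_bind _ _ _ _ 0 _ 0 _ (fun=> True)).
  by apply: runs_to_computes; [rewrite /erm_time -sred; exact: cW|].
move=> W' _.
apply: (@runs_to_bind _ _ _ _ 0 _ 0 _ (fun=> True)).
  rewrite -sred; apply: runs_to_computes => //.
  apply: (computes_foldM (g := fun c z => c + pm z.2 * sparity_val W' z.1)) => c z.
  by rewrite -addn1; apply: computes_bind (computes_sparityM _ _ _) _; exact: computes_step.
move=> c _ /=; split; last exact: sam.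
by rewrite size_rcons (proj1 ok).
Qed.

Lemma computes_score (hs : seq (rule n)) (data : seq (example n)) t :
  (size hs <= T)%N -> size data = S0 ->
  computes (R := R) (n := n) (let! c := foldM (fun c z =>
      let! v := ensembleM gamma eta (take t hs) z.1 in
      step (c + pm z.2 * pm (0 <= v))) (0 : R) data in step (- c)) score_time
    (- (\sum_(z <- data) pm z.2 * pm (0 <= ensemble gamma eta (take t hs) z.1)) : R).
Proof.
move=> hT sd; rewrite /score_time; apply: computes_bind; last exact: computes_step.
rewrite -sd -[X in computes _ _ X]add0r -foldl_sum; apply: computes_foldM => c z.
rewrite -addn1; apply: computes_bind; last exact: computes_step.
apply: computes_leq (computes_ensembleM _ _ _ _).
rewrite leq_mul2r; apply/orP; right; apply: leq_trans hT.
by rewrite size_take; case: ltnP => // /ltnW.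
Qed.

Lemma runs_to_boost (tieW : seq (example n) -> sparity n -> sparity n -> bool)
    (tie0 : seq (rule n) -> seq (example n) -> nat -> nat -> bool) :
  runs_to (boost d gamma pr tieW tie0) (T * S + S0) boost_time (fun=> True).
Proof.
apply: (runs_to_bind (I := state_ok T)).
  apply: runs_to_iterM; first by [].
  by move=> j st; exact: runs_to_round.
move=> st [sT _]; rewrite -[X in runs_to _ X]addn0.
apply: (@runs_to_bind _ _ _ _ S0 _ 0 _ (fun data => size data = S0)).
  by rewrite -[X in runs_to _ X](muln1 S0); apply: runs_to_sampleM; exact: runs_to_draw.
move=> data sdata.
have scP t := computes_score t (eq_leq sT) sdata.
have [t [ct _ _]] := computes_argminM (tie0 (rules_of st) data) 0%N (iota 0 T) scP.
rewrite -[X in runs_to _ _ X]addn0.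
apply: (@runs_to_bind _ _ _ _ 0 _ 0 _ (fun=> True)) => //.
by apply: runs_to_computes => //; rewrite size_iota in ct; exact: ct.
Qed.

End Boost.
End RunsTo.

(** * Progress of the boosting algorithm *)


Section Boosting.
Variables (R : realType) (n : nat) (D : distr R n).
Implicit Types (H X : cube n -> R) (h : classifier n).

Definition corr h : R := \sum_z D z * (pm z.2 * pm (h z.1)).

Lemma loss_corr h : loss D h = (1 - corr h) / 2.
Proof.
rewrite /loss /corr -[X in X - _](mass_sum1 D) -sumrB mulr_suml big_mkcond /=.
apply: eq_bigr => z _; rewrite -[X in X - _]mulr1 -mulrBr -mulrA.
by case: (h z.1); case: z.2; rewrite /pm /= ?mulrNN ?mulr1 ?mul1r ?subrr; field.
Qed.

Definition sgn H : classifier n := fun x => 0 <= H x.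

Definition potential H : R := \sum_z D z * phi (pm z.2 * H z.1).

(** Minus the derivative of [potential] at [H] in the direction [X]. *)
Definition descent H X : R := \sum_z D z * (- dphi (pm z.2 * H z.1) * (pm z.2 * X z.1)).

Lemma potential_ge0 H : 0 <= potential H.
Proof. by apply: sumr_ge0 => z _; rewrite mulr_ge0 ?mass_ge0 ?phi_ge0. Qed.

Lemma potential_step H X eta B : (forall x, `|X x| <= B) ->
  potential (fun x => H x + eta * X x) <=
  potential H - eta * descent H X + eta ^+ 2 * B ^+ 2 / 2.
Proof.
move=> XB.
have -> : potential H - eta * descent H X + eta ^+ 2 * B ^+ 2 / 2 =
  \sum_z D z * (phi (pm z.2 * H z.1) + dphi (pm z.2 * H z.1) * (pm z.2 * (eta * X z.1))
     + eta ^+ 2 * B ^+ 2 / 2).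
  under [RHS]eq_bigr do rewrite mulrDr mulrDr.
  rewrite 2!big_split /= -[X in _ = _ + X]mulr_suml mass_sum1 mul1r; congr (_ + _ + _).
  by rewrite /descent -mulrN -sumrN mulr_sumr; apply: eq_bigr => z _; ring.
apply: ler_sum => z _; apply: ler_wpM2l; first exact: mass_ge0.
rewrite mulrDr; apply: le_trans (phi_smooth _ _) _.
rewrite lerD2l ler_pM2r// !exprMn.
have -> : pm z.2 ^+ 2 = 1 :> R by rewrite expr2 sqr_pm.
rewrite mul1r; apply: ler_wpM2l; first exact: sqr_ge0.
by rewrite -(real_normK (num_real (X z.1))) lerXn2r ?nnegrE// (le_trans _ (XB z.1)).
Qed.

(** Pointwise: where [sgn H] errs, the weight [- dphi] is exactly 1 and both sides agree; where it
    is right, [y (f - sgn H) <= 0] and a weight of at most 1 can only increase it. *)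
Lemma descent_sign_gap H f :
  corr f - corr (sgn H) <=
  descent H (fun x => pm (f x)) - descent H (fun x => pm (sgn H x)).
Proof.
rewrite /corr /descent -!sumrB; apply: ler_sum => z _.
rewrite -!mulrBr; apply: ler_wpM2l; first exact: mass_ge0.
rewrite /sgn; case: z => x y /=.
have h1 := dphi_geN1 (pm y * H x); have h2 := dphi_lt0 (pm y * H x).
have [H0|H0] := leP 0 (H x); case: y h1 h2; rewrite /pm => h1 h2.
- by case: (f x); lra.
- have -> : dphi (-1 * H x) = -1 by rewrite /dphi ifT//; lra.
  by case: (f x); lra.
- have -> : dphi (1 * H x) = -1 by rewrite /dphi ifT//; lra.
  by case: (f x); lra.
- by case: (f x); lra.
Qed.

Lemma descent_opp H X : descent H (fun x => - X x) = - descent H X.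
Proof. by rewrite /descent -sumrN; apply: eq_bigr => z _; rewrite !mulrN. Qed.

Section Step.
Variables (eps : R) (d k : nat).
Hypotheses (eps01 : 0 < eps < 1) (n0 : (0 < n)%N) (kd : (1 < k <= d)%N)
  (k_eps : 3 <= eps ^+ 2 * Num.sqrt k%:R) (uD : uniform_marginal D).

Let gamma : R := n%:R ^- d.
(** A selected parity gives slope at least [2 e / gamma = eps / 48] against curvature [gamma^-2];
    this [eta] minimizes the resulting quadratic bound and keeps half of the first-order gain,
    namely [drop]. *)
Let eta : R := gamma ^+ 2 * eps / 48.
Let e : R := gamma * eps / 96.

Lemma edge_bounds : 0 < gamma <= 1.
Proof.
rewrite /gamma invr_gt0 exprn_gt0 ?ltr0n//= invf_le1 ?exprn_gt0 ?ltr0n//.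
by apply: exprn_ege1; rewrite ler1n.
Qed.

Lemma step_size_gt0 : 0 < eta.
Proof.
have /andP[g0 _] := edge_bounds; have /andP[e0 _] := eps01.
by rewrite /eta divr_gt0// mulr_gt0// exprn_gt0.
Qed.

Lemma step_size_le : eta <= gamma ^+ 2.
Proof.
have /andP[g0 _] := edge_bounds; have /andP[e0 e1] := eps01.
by rewrite /eta -mulrA ler_piMr ?sqr_ge0//; lra.
Qed.

Lemma step_size_le_eps : eta <= eps / 48.
Proof.
have /andP[g0 g1] := edge_bounds; have /andP[e0 e1] := eps01.
rewrite /eta -mulrA ler_piMl//; first lra.
by apply: exprn_ile1 => //; exact: ltW.
Qed.

Let drop := eta * eps / 96.

Lemma parity_step H (W : sparity n) : 2 * e <= descent H (sparity_val W) ->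
  potential (fun x => H x + eta * (sparity_val W x / gamma)) <= potential H - drop.
Proof.
move=> eW; have /andP[g0 g1] := edge_bounds; have e0 := step_size_gt0.
have XB x : `|sparity_val W x / gamma| <= gamma^-1.
  exact: (rule_val_le (Scaled W) 0 x edge_bounds).
apply: le_trans (potential_step _ _ XB) _.
have -> : descent H (fun x => sparity_val W x / gamma) = descent H (sparity_val W) / gamma.
  by rewrite /descent mulr_suml; apply: eq_bigr => z _; ring.
have h1 : eps / 48 <= descent H (sparity_val W) / gamma.
  by rewrite ler_pdivlMr//; move: eW; rewrite /e; lra.
have h2 : eta ^+ 2 * gamma^-1 ^+ 2 / 2 = eta * eps / 96.
  by rewrite /eta; field; exact: lt0r_neq0.
have := ler_wpM2l (ltW e0) h1; rewrite h2 /drop; lra.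
Qed.

(** The halfspace has descent at most [2 n^d * 11 e + eps = (22/96 + 1) eps], so a gap above
    [3/2 eps] leaves the descent along [sgn H] below [- 26/96 eps]. As a correlation gap is twice a
    loss gap, [3/2 eps] fits in the total allowance of [2 eps]. *)
Lemma sign_step H (w : 'rV[R]_n) theta :
  (forall W : sparity n, (#|W.2| <= d)%N -> descent H (sparity_val W) <= 11 * e) ->
  3 / 2 * eps < corr (halfspace w theta) - corr (sgn H) ->
  potential (fun x => H x + eta * - pm (sgn H x)) <= potential H - drop.
Proof.
move=> small gap; have /andP[g0 g1] := edge_bounds; have e0 := step_size_gt0.
have /andP[ep0 _] := eps01.
pose c z := - dphi (pm z.2 * H z.1) * pm z.2.
have cor : descent H (fun x => pm (halfspace w theta x)) <= 2 * n%:R ^+ d * (11 * e) + eps.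
  have := @halfspace_correlation_le R n D c w theta k d (11 * e) eps uD n0 kd ep0 k_eps.
  have -> : \sum_z D z * (c z * pm (halfspace w theta z.1)) =
      descent H (fun x => pm (halfspace w theta x)).
    by apply: eq_bigr => z _; rewrite /c -mulrA.
  apply=> [z|A Ad].
    rewrite /c normrM normr_pm mulr1 normrN ler_norml.
    by have := dphi_geN1 (pm z.2 * H z.1); have := dphi_lt0 (pm z.2 * H z.1); lra.
  have -> : \sum_z D z * (c z * chi R A z.1) = descent H (chi R A).
    by apply: eq_bigr => z _; rewrite /c -mulrA.
  have sp b : descent H (sparity_val (b, A)) = pm b * descent H (chi R A).
    rewrite /descent mulr_sumr; apply: eq_bigr => z _.
    by rewrite /sparity_val /chi /=; ring.
  have := small (true, A) Ad; have := small (false, A) Ad.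
  by rewrite !sp /pm ler_norml; lra.
have gn : n%:R ^+ d = gamma^-1 by rewrite /gamma invrK.
have ge : 2 * n%:R ^+ d * (11 * e) = 22 / 96 * eps.
  by rewrite gn /e; field; exact: lt0r_neq0.
rewrite ge in cor.
have gp := descent_sign_gap H (halfspace w theta).
have XB x : `|- pm (sgn H x) : R| <= 1 by rewrite normrN normr_pm.
apply: le_trans (potential_step _ _ XB) _.
rewrite descent_opp expr1n mulr1.
have ee := step_size_le_eps.
have h : descent H (fun x => pm (sgn H x)) <= - (26 / 96 * eps) by lra.
have := mulr_ge0 (ltW e0) (ltW ep0).
have := ler_wpM2l (ltW e0) h; have := ler_wpM2l (ltW e0) ee; rewrite /drop; lra.
Qed.

Variables (T S m S0 : nat).
Hypotheses (S_gt0 : (0 < S)%N) (m_gt0 : (0 < m)%N) (T_gt0 : (0 < T)%N).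
Let pr := Params eta 1 (4 * e) T S m S0.
Let p1 : R := (size (sparities n d))%:R * (2 * expR (- (S%:R * e ^+ 2 / 4))).
Let p2 : R := (size (sparities n d))%:R * (2 * expR (- (m%:R * e ^+ 2 / 4))).

Let Hof hs : cube n -> R := ensemble gamma eta hs.

Lemma sampler_lawful (st : state R n) (data : seq (example n)) : (0 < size data)%N ->
  lawful D (fun=> True) (round_sampler gamma pr st data).
Proof.
case: st => [[[hs h] prev]|] s0; last exact: lawful_pick.
exact: (round_sampler_lawful _ _ _ _ _ _ edge_bounds step_size_gt0 step_size_le).
Qed.

(** The factor is [1 + eta] after the first round. In the first round it is 1: the ensemble is 0 and
    [- dphi 0 = 1], so raw examples already have the right correlations. *)
Lemma sampler_mean (st : state R n) (data : seq (example n)) :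
  exists2 c : R, 1 <= c <= 2 & forall X,
    c * expect D (fun z => pm z.2 * X z.1) (round_sampler gamma pr st data) =
    avg data (fun z => - dphi (pm z.2 * Hof (rules_of st) z.1) * (pm z.2 * X z.1)).
Proof.
have e0 := step_size_gt0; have el := step_size_le_eps; have /andP[_ e1] := eps01.
case: st => [[[hs h] prev]|].
  exists (1 + eta) => [|X]; first lra.
  rewrite (expect_round_sampler _ _ _ _ _ _ _ step_size_gt0).
  rewrite mulNr mulrN mulrA mulfV ?mul1r; last by rewrite gt_eqF//; lra.
  by rewrite /avg -mulNr -sumrN; congr (_ / _); apply: eq_bigr => z _; rewrite mulNr.
exists 1 => [|X]; first lra.
rewrite mul1r expect_pick; congr (_ / _); apply: eq_bigr => z _.
by rewrite /Hof /ensemble /= mulr0 /dphi lexx opprK mul1r.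
Qed.

Section Halfspace.
Variables (w : 'rV[R]_n) (theta : R).

Definition good_index hs i : bool :=
  corr (halfspace w theta) - corr (sgn (Hof (take i hs))) <= 3 / 2 * eps.

(* The invariant: either an earlier [sign(H_i)] already competes with the
   halfspace, or the potential has dropped in every round. *)
Definition bad j (st : state R n) : bool :=
  ~~ (has (good_index (rules_of st)) (iota 0 j)
      || (potential (Hof (rules_of st)) <= 2 - j%:R * drop)).

Definition agreement (W : sparity n) (z : example n) : R := pm z.2 * sparity_val W z.1.

(** Both sampling errors are below [e] and the factor of [sampler_mean] lies in [[1, 2]]. An
    observed correlation above [4 e] thus means a true one above [3 e] and a descent above [2 e];
    otherwise every parity has true correlation at most [5 e], hence descent at most
    [2 * 5 e + e = 11 e]. *)
Lemma round_progress (st : state R n) (data redata : seq (example n)) (W : sparity n) j :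
  size (rules_of st) = j -> ~~ bad j st ->
  (#|W.2| <= d)%N ->
  (forall W' : sparity n, (#|W'.2| <= d)%N ->
      avg redata (agreement W') <=
      avg redata (agreement W)) ->
  (forall W' : sparity n, (#|W'.2| <= d)%N ->
    `|avg data (fun z => - dphi (pm z.2 * Hof (rules_of st) z.1) *
         agreement W' z) - descent (Hof (rules_of st)) (sparity_val W')| < e) ->
  (forall W' : sparity n, (#|W'.2| <= d)%N ->
    `|avg redata (agreement W') -
      expect D (agreement W') (round_sampler gamma pr st data)| < e) ->
  ~~ bad j.+1 (Some (rules_of st,
    (if 4 * e < avg redata (agreement W)
     then Scaled W else NegSign), round_sampler gamma pr st data)).
Proof.
move=> sj; rewrite /bad !negbK [rules_of (Some _)]/= => prog Wd maxW close1 close2.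
set hs := rules_of st in sj prog close1 *; set h := if _ then _ else _.
have tk i : (i <= j)%N -> take i (rcons hs h) = take i hs.
  by move=> ij; rewrite -cats1 takel_cat// sj.
have hasE : has (good_index (rcons hs h)) (iota 0 j) = has (good_index hs) (iota 0 j).
  apply: eq_in_has => i; rewrite mem_iota /= add0n => ij.
  by rewrite /good_index tk// ltnW.
(* The new index [j] denotes the ensemble at the start of the round, whose sign [NegSign] opposes;
   if it is not good, the gap needed by [sign_step] is available. *)
rewrite -[j.+1]addn1 iotaD has_cat add0n hasE /= orbF {2}/good_index tk// take_oversize ?sj//.
case: (boolP (has _ _)) prog => //= _ pot.
rewrite -implyNb -ltNge; apply/implyP => gap.
have HE : Hof (rcons hs h) = fun x => Hof hs x + eta * rule_val gamma h (Hof hs x) x.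
  by apply/funext => x; exact: ensemble_rcons.
suff : potential (Hof (rcons hs h)) <= potential (Hof hs) - drop.
  by rewrite -natr1; lra.
have /andP[g0 g1] := edge_bounds; have /andP[ep0 _] := eps01.
have e0 : 0 < e by rewrite /e divr_gt0// mulr_gt0.
have [c /andP[c1 c2] cE] := sampler_mean st data.
have clos (W' : sparity n) : (#|W'.2| <= d)%N -> exists P, exists2 A,
    c * P = A & [/\ `|A - descent (Hof hs) (sparity_val W')| < e &
      `|avg redata (agreement W') - P| < e].
  move=> W'd; exists (expect D (agreement W')
    (round_sampler gamma pr st data)).
  eexists; [exact: cE|split; [exact: close1|exact: close2]].
rewrite HE /h; case: ifPn => [big|].
  have [P [A cA []]] := clos W Wd.
  rewrite !ltr_norml => /andP[a1 a2] /andP[b1 b2].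
  apply: parity_step.
  have P0 : 3 * e <= P by lra.
  have : P <= c * P by rewrite ler_peMl//; lra.
  lra.
rewrite -leNgt => small.
apply: (@sign_step _ w theta) => [W' W'd|//].
have [P [A cA []]] := clos W' W'd.
rewrite !ltr_norml => /andP[a1 a2] /andP[b1 b2].
have P5 : P <= 5 * e by have := maxW W' W'd; lra.
have : c * P <= 2 * (5 * e).
  apply: le_trans (_ : c * (5 * e) <= _); first by rewrite ler_wpM2l//; lra.
  by rewrite ler_wpM2r//; lra.
lra.
Qed.

Lemma mem_sparities (W : sparity n) : (W \in sparities n d) = (#|W.2| <= d)%N.
Proof. by rewrite mem_enum. Qed.

Lemma round_end_lawful tieW j (st : state R n) sampler (redata : seq (example n)) :
  size (rules_of st) = j ->
  lawful D (fun st' : state R n => size (rules_of st') = j.+1)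
    (let! W := erm R d tieW redata in
     let! c := foldM (fun c z =>
       let! w := sparityM R W z.1 in step (c + pm z.2 * w)) 0 redata in
     let! h := step (if 4 * e < c / (size redata)%:R then Scaled W else NegSign) in
     Ret (Some (rules_of st, h, sampler))).
Proof.
move=> sj.
have [W [cW _ _]] := computes_erm R d tieW redata.
apply: (lawful_bind (lawful_computes (J := fun=> True) D cW I)) => W' _.
apply: (lawful_bind (I := fun=> True)) => [|c _].
  have cS : computes (foldM (fun c z =>
      let! w := sparityM R W' z.1 in step (c + pm z.2 * w)) (0 : R) redata)
    (size redata * (2 * n + 1).+1)
    (foldl (fun c z => c + pm z.2 * sparity_val W' z.1) 0 redata).
    apply: computes_foldM => c z.
    by apply: computes_bind (computes_sparityM _ _ _) _; exact: computes_step.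
  exact: lawful_computes cS I.
by apply: lawful_tick; apply: lawful_ret; rewrite /= size_rcons sj.
Qed.

Lemma round_rest_lawful tieW j (st : state R n) (data : seq (example n)) :
  size (rules_of st) = j -> (0 < size data)%N ->
  lawful D (fun st' : state R n => size (rules_of st') = j.+1)
    (let sampler := round_sampler gamma pr st data in
     let! redata := sampleM m sampler in
     let! W := erm R d tieW redata in
     let! c := foldM (fun c z =>
       let! w := sparityM R W z.1 in step (c + pm z.2 * w)) 0 redata in
     let! h := step (if 4 * e < c / (size redata)%:R then Scaled W else NegSign) in
     Ret (Some (rules_of st, h, sampler))).
Proof.
move=> sj s0.
apply: (lawful_bind (lawful_sampleM m (sampler_lawful st s0))) => redata _.
exact: round_end_lawful.
Qed.

Lemma round_lawful tieW j (st : state R n) : size (rules_of st) = j ->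
  lawful D (fun st' => size (rules_of st') = j.+1) (round d gamma pr tieW st).
Proof.
move=> sj; apply: (lawful_bind (lawful_sampleM S (lawful_draw D))) => data sdata.
by apply: round_rest_lawful => //; rewrite sdata.
Qed.

(** The ensemble is fixed before [data] is drawn, and the sampler before [redata], so each stage is
    Hoeffding's inequality with a union bound over the parities; these give [p1] and [p2]. *)
Lemma round_bad tieW j (st : state R n) : size (rules_of st) = j -> ~~ bad j st ->
  prob D (bad j.+1) (round d gamma pr tieW st) <= p1 + p2.
Proof.
move=> sj gst.
have /andP[g0 g1] := edge_bounds; have /andP[ep0 ep1] := eps01.
have e0 : 0 < e by rewrite /e divr_gt0// mulr_gt0.
have e13 : 0 <= e <= 1 / 3.
  by rewrite ltW//= /e; have := ler_pM (ltW g0) (ltW ep0) g1 (ltW ep1); lra.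
have pge0 k' : 0 <= (size (sparities n d))%:R * (2 * expR (- (k'%:R * e ^+ 2 / 4))) :> R.
  by rewrite mulr_ge0// mulr_ge0// expR_ge0.
set H := Hof (rules_of st).
pose X (W : sparity n) z : R := - dphi (pm z.2 * H z.1) * (pm z.2 * sparity_val W z.1).
pose Y := agreement.
have Y1 W z : `|Y W z| <= 1.
  by have [b E] := sparity_val_pm R W z.1; rewrite /Y /agreement E normrM !normr_pm mulr1.
have X1 W z : `|X W z| <= 1.
  rewrite /X normrM normrN -[leRHS]mulr1; apply: ler_pM => //; last exact: Y1.
  rewrite ler_norml; have := dphi_geN1 (pm z.2 * H z.1).
  by have := dphi_lt0 (pm z.2 * H z.1); lra.
apply: (prob_bind (bad := fun data => has (fun W =>
    e <= `|avg data (X W) - expect D (X W) draw|) (sparities n d))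
  (pge0 m) (lawful_sampleM S (lawful_draw D))
  (fun data sdata => round_rest_lawful tieW sj
    (eq_ind_r (fun i => (0 < i)%N) S_gt0 sdata))).
- apply: (prob_has (E := fun W data => e <= `|avg data (X W) - expect D (X W) draw|)
    _ (lawful_sampleM S (lawful_draw D))) => W.
  apply: (hoeffding (lawful_draw D)) => // z _; exact: X1.
move=> data sdata /hasPn close1.
have s0 : (0 < size data)%N by rewrite sdata.
have lR := sampler_lawful st s0.
rewrite -[leRHS]addr0.
apply: (prob_bind (bad := fun redata => has (fun W =>
    e <= `|avg redata (Y W) - expect D (Y W) (round_sampler gamma pr st data)|)
    (sparities n d)) (lexx 0) (lawful_sampleM m lR)
    (fun redata _ => round_end_lawful tieW _ redata sj)).
- apply: (prob_has (E := fun W redata => e <= `|avg redata (Y W) -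
    expect D (Y W) (round_sampler gamma pr st data)|) _ (lawful_sampleM m lR)) => W.
  apply: (hoeffding lR) => // z _; exact: Y1.
move=> redata sredata /hasPn close2.
have [W [cW Wd maxW]] := computes_erm R d tieW redata.
rewrite /prob (expect_computes_bind _ _ _ cW).
have cS : computes (R := R) (n := n) (foldM (fun c z =>
      let! w := sparityM R W z.1 in step (c + pm z.2 * w)) (0 : R) redata)
    (size redata * (2 * n + 1).+1) (\sum_(z <- redata) pm z.2 * sparity_val W z.1).
  rewrite -[X in computes _ _ X]add0r -foldl_sum; apply: computes_foldM => c z.
  by apply: computes_bind (computes_sparityM _ _ _) _; exact: computes_step.
rewrite (expect_computes_bind _ _ _ cS) /=.
rewrite (negbTE (round_progress sj gst Wd maxW _ _))//.
- move=> W' W'd; have := close1 W'; rewrite mem_sparities -ltNge expect_draw; exact.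
- move=> W' W'd; have := close2 W'; rewrite mem_sparities -ltNge; exact.
Qed.

Lemma selection_lawful (tie0 : seq (rule n) -> seq (example n) -> nat -> nat -> bool)
    (hs : seq (rule n)) (data0 : seq (example n)) : size hs = T -> size data0 = S0 ->
  lawful D (fun=> True) (let! t := argminM (tie0 hs data0)
    (fun t =>
       let! c := foldM (fun c z =>
           let! v := ensembleM gamma eta (take t hs) z.1 in
           step (c + pm z.2 * pm (0 <= v))) 0 data0 in
       step (- c))
    0%N (iota 0 T) in
  Ret (fun x => 0 <= ensemble gamma eta (take t hs) x)).
Proof.
move=> sT sd.
have scP t := computes_score gamma eta t (eq_leq sT) sd.
have [t [ct _ _]] := computes_argminM (tie0 hs data0) 0%N (iota 0 T) scP.
by apply: (lawful_bind (lawful_computes (J := fun=> True) D ct I)) => t' _; exact: lawful_ret.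
Qed.

Lemma selection_bad (tie0 : seq (rule n) -> seq (example n) -> nat -> nat -> bool)
    (st : state R n) : (0 < S0)%N -> size (rules_of st) = T -> 2 < T%:R * drop ->
  ~~ bad T st ->
  prob D (fun h => ~~ (corr (halfspace w theta) - corr h <= 7 / 4 * eps))
   (let hs := rules_of st in
    let! data0 := sampleM S0 draw in
    let! t := argminM (tie0 hs data0)
    (fun t =>
       let! c := foldM (fun c z =>
           let! v := ensembleM gamma eta (take t hs) z.1 in
           step (c + pm z.2 * pm (0 <= v))) 0 data0 in
       step (- c))
    0%N (iota 0 T) in
    Ret (fun x => 0 <= ensemble gamma eta (take t hs) x)) <=
  T%:R * (2 * expR (- (S0%:R * (eps / 8) ^+ 2 / 4))).
Proof.
move=> S00 sT Tdrop; rewrite /bad negbK; set hs := rules_of st in sT *.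
have /andP[ep0 ep1] := eps01.
(* After [T] drops the potential would be negative, so the invariant leaves only a good index. *)
rewrite leNgt (lt_le_trans _ (potential_ge0 _)) ?orbF; last lra.
move=> /hasP[i iT good] /=.
pose Z t z : R := pm z.2 * pm (sgn (Hof (take t hs)) z.1).
have EZ t : expect D (Z t) draw = corr (sgn (Hof (take t hs))) by rewrite expect_draw.
rewrite -[leRHS]addr0.
have lS := lawful_sampleM S0 (lawful_draw D).
apply: (prob_bind (bad := fun data => has (fun t =>
    eps / 8 <= `|avg data (Z t) - expect D (Z t) draw|) (iota 0 T)) (lexx 0) lS
  (fun data0 sd => selection_lawful tie0 sT sd)).
  rewrite -[in leRHS](size_iota 0 T).
  apply: (prob_has (E := fun t data => eps / 8 <= `|avg data (Z t) - expect D (Z t) draw|)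
    _ lS) => t.
  apply: (hoeffding (lawful_draw D)) => // [z _|]; last lra.
  by rewrite /Z normrM !normr_pm mulr1.
move=> data0 sd /hasPn close.
have scP t := computes_score gamma eta t (eq_leq sT) sd.
have [t [ct inT minT]] := computes_argminM (tie0 hs data0) 0%N (iota 0 T) scP.
rewrite /prob (expect_computes_bind _ _ _ ct) /=.
have tT : t \in iota 0 T.
  move: inT; rewrite -mem_In inE => /orP[/eqP->|//].
  by rewrite mem_iota.
have cmp : avg data0 (Z i) <= avg data0 (Z t).
  have /minT : List.In i (0%N :: iota 0 T) by rewrite -mem_In inE iT orbT.
  by rewrite lerN2 /avg; apply: ler_wpM2r; rewrite invr_ge0.
have := close _ iT; have := close _ tT; rewrite -!ltNge !EZ.
move: good; rewrite /good_index !ltr_norml => g /andP[a1 a2] /andP[b1 b2].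
have E : corr (halfspace w theta) - corr (sgn (Hof (take t hs))) <= 7 / 4 * eps by lra.
by rewrite ltNge [X in ~~ X]E.
Qed.

Lemma boost_bad tieW tie0 : (0 < S0)%N -> 2 < T%:R * drop ->
  prob D (fun h => ~~ (corr (halfspace w theta) - corr h <= 7 / 4 * eps))
    (boost d gamma pr tieW tie0) <=
  T%:R * (p1 + p2) + T%:R * (2 * expR (- (S0%:R * (eps / 8) ^+ 2 / 4))).
Proof.
move=> S00 Tdrop.
have pge0 k' : 0 <= (size (sparities n d))%:R * (2 * expR (- (k'%:R * e ^+ 2 / 4))) :> R.
  by rewrite mulr_ge0// mulr_ge0// expR_ge0.
have lI : lawful D (fun st : state R n => size (rules_of st) = T)
    (Defs.iterM T (round d gamma pr tieW) None).
  apply: (@lawful_iterM _ _ D _ (fun j st => size (rules_of st) = j) _ T None 0%N) => //.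
  by move=> j st _; exact: round_lawful.
apply: (prob_bind (bad := bad T) (J := fun=> True) _ lI).
- by rewrite mulr_ge0// mulr_ge0// expR_ge0.
- move=> st sT; apply: (lawful_bind (lawful_sampleM S0 (lawful_draw D))) => data0 sd.
  exact: selection_lawful.
- apply: (@prob_iterM _ _ D _ (fun j st => size (rules_of st) = j) bad _ T None 0%N) => //.
  + by rewrite addr_ge0// pge0.
  + rewrite /bad negbK mul0r subr0 /= /potential.
    under eq_bigr do rewrite /Hof /ensemble /= mulr0 /phi lexx subr0.
    by rewrite -mulr_suml mass_sum1 mul1r.
  + by move=> j st _; exact: round_lawful.
  + by move=> j st _; exact: round_bad.
- by move=> st sT gst; exact: selection_bad.
Qed.

Lemma boost_lawful tieW tie0 : lawful D (fun=> True) (boost d gamma pr tieW tie0).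
Proof.
have lI : lawful D (fun st : state R n => size (rules_of st) = T)
    (Defs.iterM T (round d gamma pr tieW) None).
  apply: (@lawful_iterM _ _ D _ (fun j st => size (rules_of st) = j) _ T None 0%N) => //.
  by move=> j st _; exact: round_lawful.
apply: (lawful_bind lI) => st sT.
apply: (lawful_bind (lawful_sampleM S0 (lawful_draw D))) => data0 sd.
exact: selection_lawful.
Qed.

End Halfspace.

Lemma boost_success tieW tie0 delta : (0 < S0)%N -> 2 < T%:R * drop ->
  T%:R * (p1 + p2) + T%:R * (2 * expR (- (S0%:R * (eps / 8) ^+ 2 / 4))) <= delta ->
  1 - delta <= prob D (fun h => loss D h <= opt_halfspace D + eps)
    (boost d gamma pr tieW tie0).
Proof.
move=> S00 Tdrop small; have /andP[ep0 ep1] := eps01.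
rewrite (prob_compl _ (boost_lawful tieW tie0)) lerD2l lerN2.
set L := [set l | exists (w : 'rV[R]_n) (theta : R), l = loss D (halfspace w theta)]%classic.
have hL : has_inf L.
  split; first by exists (loss D (halfspace (0 : 'rV[R]_n) 0)); exists 0, 0.
  by exists 0 => _ [w [theta ->]]; apply: sumr_ge0 => z _; exact: mass_ge0.
have e8 : 0 < eps / 8 by lra.
(* One halfspace within [eps / 8] of the infimum is fixed before the run. The correlation gap
   [7/4 eps], that is [3/2 eps] plus two selection errors [eps / 8], costs [7/8 eps] of loss. *)
have [_ [w [theta ->]] near] := inf_adherent e8 hL.
apply: le_trans small; apply: le_trans (boost_bad w theta tieW tie0 S00 Tdrop).
apply: (prob_le (boost_lawful tieW tie0)) => h _; apply: contra.
move: near; rewrite -/(opt_halfspace D) !loss_corr; lra.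
Qed.

End Step.
End Boosting.

(** * Parameters *)


Lemma boost_time_le n T S d : (0 < n)%N -> (0 < T)%N -> (0 < S)%N ->
  (0 < size (sparities n d))%N ->
  (boost_time n T S S S d <= 60 * (size (sparities n d) * S * T ^ 2 * n))%N.
Proof.
rewrite /boost_time /round_time /score_time /erm_time /relabel_time.
move: (size _) => b.
case: b => // b; case: n => // n; case: T => // T; case: S => // S _ _ _ _.
nia.
Qed.

Lemma size_sparities n d : (0 < n)%N ->
  (0 < size (sparities n d) <= 4 * n ^ (2 * d))%N.
Proof.
move=> n0; rewrite -cardE; apply/andP; split.
  by apply/card_gt0P; exists (true, finset.set0); rewrite inE /= cards0.
have -> : #|[pred W : sparity n | (#|W.2| <= d)%N]| =
    (#|{: bool}| * #|[pred A : {set 'I_n} | (#|A| <= d)%N]|)%N.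
  by rewrite -cardX; apply: eq_card => -[b A]; rewrite !inE.
by rewrite card_bool; have := card_small_sets d n0; lia.
Qed.

Lemma ln2_ge_half (R : realType) : 1 / 2 <= ln 2 :> R.
Proof.
have := @le_ln1Dx R (- (1 / 2)); rewrite (_ : 1 - 1 / 2 = 2^-1); last by field.
rewrite lnV ?posrE//; lra.
Qed.

(** Absorbs constants and powers of [eps^-1] into powers of [N = max n 2], as [ln N >= 1 / 2]; base
    [n] would fail at [n = 1]. *)
Lemma le_powR_double (R : realType) (N t : R) : 2 <= N -> 0 <= t -> t <= N `^ (2 * t).
Proof.
move=> N2 t0; rewrite /powR gt_eqF; last lra.
have lN : 1 / 2 <= ln N.
  by apply: le_trans (ln2_ge_half R) _; rewrite ler_ln ?posrE//; lra.
apply: le_trans (expR_ge1Dx _); have := ler_wpM2l t0 lN; lra.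
Qed.

Lemma mul_ln_le_powR (R : realType) (N t : R) : 1 <= N -> t * ln N <= N `^ t.
Proof.
by move=> N1; rewrite -ln_powR; apply/ltW/ln_sublinear/powR_gt0; lra.
Qed.

Section Numerics.
Variables (R : realType) (eps delta : R) (n d : nat).
Hypotheses (eps01 : 0 < eps < 1) (delta01 : 0 < delta < 1) (n0 : (0 < n)%N).
Hypothesis d_le : d%:R <= 10 * eps ^- 4.

Let G : R := n%:R ^+ d.
(* [Q] is the inverse square of the accuracy [gamma * eps / 96] required of the
   empirical correlations; each round then lowers the potential by [2 / Q]. *)
Let Q : R := (96 * G / eps) ^+ 2.
Let b := size (sparities n d).

Definition round_count := (Num.trunc Q).+1.
Let T := round_count.
(** With [b] parities and [T] rounds, [S > 4 Q L] makes each tail at most [delta / (8 b T)]. The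
    rounds then fail with probability at most [delta / 2] and the selection with at most
    [delta / 4]. *)
Let L : R := ln (8 * b%:R * T%:R / delta).
Definition sample_count := (Num.trunc (4 * Q * L)).+1.
Let S := sample_count.
Let c0 : R := 64 * 96 ^+ 2.

Let eps_gt0 : 0 < eps. Proof. by case/andP: eps01. Qed.
Let delta_gt0 : 0 < delta. Proof. by case/andP: delta01. Qed.

Lemma growth_ge1 : 1 <= G.
Proof. by apply: exprn_ege1; rewrite ler1n. Qed.

Lemma accuracy_ge1 : 1 <= Q.
Proof.
apply: exprn_ege1; rewrite ler_pdivlMr// mul1r; have := growth_ge1.
by case/andP: eps01; lra.
Qed.

Lemma round_count_bounds : Q < T%:R <= 2 * Q.
Proof.
have Q1 := accuracy_ge1.
have /andP[t1 t2] := Num.Theory.truncn_itv (le_trans ler01 Q1).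
by rewrite /T /round_count t2 -natr1; lra.
Qed.

Lemma branching_bounds : 1 <= (b%:R : R) <= 4 * G ^+ 2.
Proof.
have /andP[b1 b2] := size_sparities d n0; rewrite ler1n b1 /=.
by rewrite /G -exprM mulnC -natrX -natrM ler_nat.
Qed.

Lemma log_ge0 : 0 <= L.
Proof.
apply: ln_ge0; rewrite ler_pdivlMr// mul1r.
have /andP[b1 _] := branching_bounds.
have /andP[T1 _] := round_count_bounds; have Q1 := accuracy_ge1.
have : 1 <= b%:R * T%:R :> R by rewrite mulr_ege1//; lra.
by case/andP: delta01; lra.
Qed.

Lemma sample_count_bounds : 4 * Q * L < S%:R <= 4 * Q * (L + 1).
Proof.
have Q1 := accuracy_ge1; have L0 := log_ge0.
have QL : 0 <= 4 * Q * L by rewrite mulr_ge0//; lra.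
have /andP[t1 t2] := Num.Theory.truncn_itv QL.
by rewrite /S /sample_count t2 -natr1; lra.
Qed.

(** Inserting [b <= 4 G^2] and [T <= 2 Q] bounds the argument of [L] by [c0 * G^4 * eps^-2 / delta];
    the 40 is four times the factor 10 in [d_le]. *)
Lemma log_le : L + 1 <= (c0 + 1) + 40 * (eps ^- 4 * ln n%:R) + 2 * ln eps^-1 + ln delta^-1.
Proof.
have /andP[b1 b2] := branching_bounds; have /andP[T1 T2] := round_count_bounds.
have Q1 := accuracy_ge1; have G1 := growth_ge1.
have T0 : 0 < T%:R :> R by lra.
have c00 : 0 < c0 by rewrite /c0 mulr_gt0// exprn_gt0.
have G0 : 0 < G by lra.
have le : 8 * b%:R * T%:R / delta <= c0 * (G ^+ 4 * (eps^-1 ^+ 2 * delta^-1)).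
  apply: le_trans (_ : 8 * (4 * G ^+ 2) * (2 * Q) / delta <= _).
    by rewrite ler_pM2r ?invr_gt0//; apply: ler_pM; rewrite ?mulr_ge0 ?ler_pM2l.
  rewrite le_eqVlt; apply/orP; left; apply/eqP; rewrite /Q /c0.
  by field; rewrite !gt_eqF.
have pos : 0 < 8 * b%:R * T%:R / delta.
  by rewrite divr_gt0// mulr_gt0//; lra.
have := le; rewrite -ler_ln ?posrE//; last exact: lt_le_trans le.
have e2 : 0 < eps^-1 ^+ 2 by rewrite exprn_gt0// invr_gt0.
have di : 0 < delta^-1 by rewrite invr_gt0.
have G4 : 0 < G ^+ 4 by rewrite exprn_gt0.
have E : ln (G ^+ 4 * (eps^-1 ^+ 2 * delta^-1)) =
    4 * ln G + (2 * ln eps^-1 + ln delta^-1) :> R.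
  rewrite lnM ?posrE; [|exact: G4|exact: mulr_gt0].
  by rewrite lnXn// (@lnM _ (eps^-1 ^+ 2)) ?posrE// (@lnXn _ 2 eps^-1) ?invr_gt0// !mulr_natl.
have lnMc (Z : R) : 0 < Z -> ln (c0 * Z) = ln c0 + ln Z by move=> Z0; rewrite lnM.
rewrite lnMc ?E -/L; last by rewrite mulr_gt0// mulr_gt0.
have lc : ln c0 < c0 := ln_sublinear c00.
have lG : ln G = d%:R * ln n%:R by rewrite /G lnXn ?ltr0n// mulr_natl.
have ln0 : 0 <= ln n%:R :> R by apply: ln_ge0; rewrite ler1n.
have := ler_wpM2r ln0 d_le; rewrite -lG; lra.
Qed.

Let x := eps ^- 4.
Let y : R := n%:R `^ x.

Lemma inv_eps_gt1 : 1 < eps^-1.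
Proof. by rewrite invf_gt1//; case/andP: eps01. Qed.

Lemma quartic_ge1 : 1 <= x.
Proof. by rewrite /x -exprVn; apply: exprn_ege1; exact/ltW/inv_eps_gt1. Qed.

Lemma n_powR_ge1 : 1 <= y.
Proof.
rewrite -(powRr0 n%:R); apply: ler_powR; first by rewrite ler1n.
by have := quartic_ge1; lra.
Qed.

Lemma growth_le k : G ^+ k <= y ^+ (10 * k).
Proof.
rewrite exprM; apply: lerXn2r; rewrite ?nnegrE ?exprn_ge0 ?powR_ge0//.
rewrite /G /y -!powR_mulrn ?powR_ge0// -powRrM; apply: ler_powR; first by rewrite ler1n.
by rewrite mulrC.
Qed.

Let LL : R := 1 + ln (n%:R / (eps * delta)).

Lemma log_total : ln (n%:R / (eps * delta)) = ln n%:R + ln eps^-1 + ln delta^-1 :> R.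
Proof.
have np : 0 < n%:R :> R by rewrite ltr0n.
rewrite ln_div ?posrE ?mulr_gt0// lnM ?posrE// !lnV ?posrE//; lra.
Qed.

Lemma log_n_ge0 : 0 <= ln n%:R :> R. Proof. by apply: ln_ge0; rewrite ler1n. Qed.

Lemma log_inv_eps_ge0 : 0 <= ln eps^-1 :> R.
Proof. by apply: ln_ge0; exact/ltW/inv_eps_gt1. Qed.

Lemma log_inv_delta_ge0 : 0 <= ln delta^-1 :> R.
Proof. by apply: ln_ge0; apply/ltW; rewrite invf_gt1//; case/andP: delta01. Qed.

(** [T * S] is of order [Q^2 * L], that is [G^4 * eps^-4 * L]. Here [G^4 <= y^40], and the
    [eps^-4 * ln n] inside [L] costs one more [y]. *)
Lemma samples_le : (T * S + S)%:R <=
  (12 * 96 ^+ 4 * (c0 + 43)) * LL ^+ 1 * (eps ^- 7 * n%:R `^ (60 * eps ^- 4)).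
Proof.
have /andP[T1 T2] := round_count_bounds; have /andP[S1 S2] := sample_count_bounds.
have Q1 := accuracy_ge1; have L0 := log_ge0; have y1 := n_powR_ge1.
have c00 : 0 < c0 by rewrite /c0 mulr_gt0// exprn_gt0.
have LL1 : 1 <= LL.
  by rewrite /LL log_total; have := log_n_ge0; have := log_inv_eps_ge0;
     have := log_inv_delta_ge0; lra.
have logy : L + 1 <= (c0 + 43) * (y * LL).
  apply: le_trans log_le _.
  have xy : x * ln n%:R <= y by apply: mul_ln_le_powR; rewrite ler1n.
  have h1 : c0 + 1 <= (c0 + 1) * (y * LL) by rewrite ler_peMr ?mulr_ege1//; lra.
  have h2 : y <= y * LL by rewrite ler_peMr//; lra.
  have h3 : 2 * ln eps^-1 + ln delta^-1 <= 2 * LL.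
    by rewrite /LL log_total; have := log_n_ge0; have := log_inv_delta_ge0; lra.
  have h4 : LL <= y * LL by rewrite ler_peMl//; lra.
  by rewrite -/x; lra.
have TS : (T * S + S)%:R <= 12 * Q ^+ 2 * (L + 1).
  rewrite natrD natrM.
  apply: le_trans (_ : (T%:R + 1) * S%:R <= _); first by rewrite mulrDl mul1r.
  apply: le_trans (_ : (3 * Q) * (4 * Q * (L + 1)) <= _); last by rewrite le_eqVlt;
    apply/orP; left; apply/eqP; ring.
  by apply: ler_pM => //; lra.
apply: le_trans TS _.
have Q2 : Q ^+ 2 = 96 ^+ 4 * (G ^+ 4 * eps^-1 ^+ 4) by rewrite /Q; field; exact: lt0r_neq0.
have e47 : eps^-1 ^+ 4 <= eps^-1 ^+ 7.
  by apply: ler_weXn2l => //; exact/ltW/inv_eps_gt1.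
have G4 := growth_le 4.
have G0 : 0 <= G := le_trans ler01 growth_ge1.
have e0 : 0 <= eps^-1 by rewrite invr_ge0 ltW.
have y60 : y ^+ 41 <= n%:R `^ (60 * eps ^- 4).
  rewrite mulrC powRrM -/x -/y -[y ^+ 41]powR_mulrn ?powR_ge0//.
  by apply: ler_powR => //; rewrite ler_nat.
have main : Q ^+ 2 * (L + 1) <= 96 ^+ 4 * (y ^+ 40 * eps^-1 ^+ 7) * ((c0 + 43) * (y * LL)).
  have G40 : 0 <= G ^+ 4 * eps^-1 ^+ 4 by apply: mulr_ge0; apply: exprn_ge0.
  rewrite Q2; apply: ler_pM logy; [|lra|].
    by apply: mulr_ge0 G40; apply: exprn_ge0; exact: ler0n.
  by rewrite ler_pM2l ?exprn_gt0//; apply: ler_pM; rewrite ?exprn_ge0.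
apply: le_trans (_ : 12 * (96 ^+ 4 * (y ^+ 40 * eps^-1 ^+ 7) * ((c0 + 43) * (y * LL))) <= _).
  by rewrite -mulrA ler_pM2l.
apply: le_trans (_ : 12 * 96 ^+ 4 * (c0 + 43) * LL ^+ 1 * (eps ^- 7 * y ^+ 41) <= _).
  rewrite -exprVn le_eqVlt; apply/orP; left; apply/eqP; ring.
apply: ler_wpM2l; last by apply: ler_wpM2l y60; rewrite -exprVn exprn_ge0.
rewrite expr1; apply: mulr_ge0; last lra.
apply: mulr_ge0; last lra.
by apply: mulr_ge0; [exact: ler0n|apply: exprn_ge0; exact: ler0n].
Qed.

Let N : R := (maxn n 2)%:R.
Let C : R := 3840 * 96 ^+ 6 * (c0 + 44).

(** The exponent 85 is 80 for [G^8] (from [b * S * T^2]), 1 for the logarithm and 4 for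
    [eps^-7 <= x^2 <= Y^4]; the constant term absorbs the factors [n] and [C]. *)
Lemma time_le : (boost_time n T S S S d)%:R <=
  (1 + ln delta^-1) ^+ 1 * N `^ (85 * eps ^- 4 + (2 * C + 1)).
Proof.
have /andP[T1 T2] := round_count_bounds; have /andP[S1 S2] := sample_count_bounds.
have /andP[b1 b2] := branching_bounds.
have Q1 := accuracy_ge1; have L0 := log_ge0; have y1 := n_powR_ge1.
have ld := log_inv_delta_ge0; have e1 := inv_eps_gt1; have x1 := quartic_ge1.
have c00 : 0 < c0 by rewrite /c0 mulr_gt0// exprn_gt0.
have G0 : 0 <= G := le_trans ler01 growth_ge1.
have C0 : 0 <= C.
  apply: mulr_ge0; last lra.
  by apply: mulr_ge0; [exact: ler0n|apply: exprn_ge0; exact: ler0n].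
have N2 : 2 <= N by rewrite /N ler_nat leq_maxr.
have nN : n%:R <= N by rewrite /N ler_nat leq_maxl.
pose Y := N `^ x.
have Y1 : 1 <= Y by rewrite -(powRr0 N); apply: ler_powR; lra.
have yY : y <= Y by apply: ge0_ler_powR; rewrite ?nnegrE//; lra.
have y0 : 0 <= y by lra.
set DD := 1 + ln delta^-1.
have logd : L + 1 <= (c0 + 44) * (y * eps^-1 * DD).
  apply: le_trans log_le _.
  have xy : x * ln n%:R <= y by apply: mul_ln_le_powR; rewrite ler1n.
  have le1 : ln eps^-1 < eps^-1 by apply: ln_sublinear; lra.
  have D1 : 1 <= DD by rewrite /DD; lra.
  have ye : 1 <= y * eps^-1 by rewrite mulr_ege1// ltW.
  have h1 : c0 + 1 <= (c0 + 1) * (y * eps^-1 * DD) by rewrite ler_peMr ?mulr_ege1//; lra.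
  have h2 : y <= y * eps^-1 by rewrite ler_peMr// ltW.
  have h3 : eps^-1 <= y * eps^-1 by rewrite ler_peMl//; lra.
  have h4 : y * eps^-1 <= y * eps^-1 * DD by rewrite ler_peMr//; lra.
  have h5 : DD <= y * eps^-1 * DD by rewrite ler_peMl//; lra.
  by move: h5; rewrite {1}/DD -/x; lra.
have /andP[b_gt0 _] := size_sparities d n0.
apply: le_trans (_ : (60 * (b * S * T ^ 2 * n))%:R <= _).
  by rewrite ler_nat; exact: boost_time_le.
apply: le_trans (_ : 60 * ((4 * G ^+ 2) * (4 * Q * (L + 1)) * (2 * Q) ^+ 2 * n%:R) <= _).
  rewrite 4!natrM natrX ler_pM2l// ler_wpM2r//.
  apply: ler_pM; rewrite ?mulr_ge0 ?exprn_ge0//.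
    by apply: ler_pM.
  by rewrite lerXn2r ?nnegrE//; lra.
have Q3 : Q ^+ 3 = 96 ^+ 6 * (G ^+ 6 * eps^-1 ^+ 6) by rewrite /Q; field; exact: lt0r_neq0.
apply: le_trans (_ : 3840 * (G ^+ 2 * Q ^+ 3 * n%:R * ((c0 + 44) * (y * eps^-1 * DD))) <= _).
  have -> : 60 * (4 * G ^+ 2 * (4 * Q * (L + 1)) * (2 * Q) ^+ 2 * n%:R) =
     3840 * (G ^+ 2 * Q ^+ 3 * n%:R * (L + 1)) by ring.
  apply: ler_wpM2l; first exact: ler0n.
  have Q0 : 0 <= Q by lra.
  apply: ler_wpM2l logd.
  exact: mulr_ge0 (mulr_ge0 (exprn_ge0 2 G0) (exprn_ge0 3 Q0)) (ler0n R n).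
rewrite Q3.
have -> : 3840 * (G ^+ 2 * (96 ^+ 6 * (G ^+ 6 * eps^-1 ^+ 6)) * n%:R *
    ((c0 + 44) * (y * eps^-1 * DD))) = C * (DD * (G ^+ 8 * y * (eps^-1 ^+ 7 * n%:R))).
  by rewrite /C; ring.
have e78 : eps^-1 ^+ 7 <= x ^+ 2.
  by rewrite /x -exprVn -exprM; apply: ler_weXn2l => //; exact: ltW.
have xY : x <= Y ^+ 2.
  by rewrite -powR_mulrn ?powR_ge0// -powRrM mulrC; apply: le_powR_double => //; lra.
have CN : C <= N `^ (2 * C) by exact: le_powR_double.
have -> : N `^ (85 * eps ^- 4 + (2 * C + 1)) = N `^ (2 * C) * (Y ^+ 80 * Y * ((Y ^+ 2) ^+ 2 * N)).
  have P r s : N `^ (r + s) = N `^ r * N `^ s.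
    have Nn0 : N != 0 by rewrite gt_eqF//; lra.
    by rewrite powRD// Nn0 implybT.
  have N0 : 0 <= N by lra.
  rewrite P (P (2 * C)) (powRr1 N0).
  rewrite -/x (mulrC 85 x) (powRrM N x 85) -/Y.
  have -> : Y `^ 85 = Y ^+ 85 by rewrite -powR_mulrn// powR_ge0.
  ring.
rewrite expr1 -/DD.
have D0 : 0 <= DD by rewrite /DD; lra.
rewrite (mulrCA C DD); apply: ler_wpM2l => //.
have e0 : 0 <= eps^-1 by lra.
have Y0 : 0 <= Y by lra.
have en0 : 0 <= eps^-1 ^+ 7 * n%:R by apply: mulr_ge0 => //; exact: exprn_ge0.
have Gy0 : 0 <= G ^+ 8 * y by apply: mulr_ge0 => //; exact: exprn_ge0.
apply: (ler_pM C0 (mulr_ge0 Gy0 en0) CN).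
apply: (ler_pM Gy0 en0).
  apply: (ler_pM (exprn_ge0 _ G0) y0 _ yY).
  by apply: le_trans (growth_le 8) _; rewrite lerXn2r ?nnegrE.
apply: ler_pM; rewrite ?exprn_ge0//.
apply: le_trans e78 _; rewrite lerXn2r ?nnegrE ?exprn_ge0//; lra.
Qed.


Let gamma : R := n%:R ^- d.
Let e : R := gamma * eps / 96.

Lemma sqr_accuracy : e ^+ 2 = Q^-1.
Proof.
have G0 : G != 0 by rewrite gt_eqF//; have := growth_ge1; lra.
by rewrite /e /gamma -/G /Q; field; rewrite G0 gt_eqF.
Qed.

Lemma round_count_drop : 2 < T%:R * (gamma ^+ 2 * eps / 48 * eps / 96).
Proof.
have -> : gamma ^+ 2 * eps / 48 * eps / 96 = 2 * e ^+ 2 by rewrite /e; field.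
rewrite sqr_accuracy; have /andP[T1 _] := round_count_bounds; have Q1 := accuracy_ge1.
rewrite mulrA ltr_pdivlMr; lra.
Qed.

Lemma failure_le :
  T%:R * ((b%:R * (2 * expR (- (S%:R * e ^+ 2 / 4)))) + (b%:R * (2 * expR (- (S%:R * e ^+ 2 / 4)))))
  + T%:R * (2 * expR (- (S%:R * (eps / 8) ^+ 2 / 4))) <= delta.
Proof.
have /andP[T1 T2] := round_count_bounds; have /andP[S1 S2] := sample_count_bounds.
have /andP[b1 b2] := branching_bounds; have Q1 := accuracy_ge1.
have pos : 0 < 8 * b%:R * T%:R / delta by rewrite divr_gt0// mulr_gt0//; lra.
have tail : expR (- (S%:R * e ^+ 2 / 4)) <= delta / (8 * b%:R * T%:R).
  apply: le_trans (_ : expR (- L) <= _); last by rewrite expRN lnK// invf_div.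
  rewrite ler_expR lerN2 sqr_accuracy ler_pdivlMr// ler_pdivlMr; lra.
have e8 : e ^+ 2 <= (eps / 8) ^+ 2.
  have g0 : 0 <= gamma by rewrite /gamma invr_ge0 exprn_ge0.
  have g1 : gamma <= 1.
    by rewrite /gamma invf_le1 ?exprn_gt0 ?ltr0n// exprn_ege1// ler1n.
  have ge : gamma * eps <= eps by rewrite ler_piMl// ltW.
  have ge0 : 0 <= gamma * eps by rewrite mulr_ge0// ltW.
  by rewrite lerXn2r ?nnegrE /e//; lra.
have tail' : expR (- (S%:R * (eps / 8) ^+ 2 / 4)) <= delta / (8 * b%:R * T%:R).
  apply: le_trans tail; rewrite ler_expR lerN2 ler_pM2r// ler_wpM2l//.
have T0 : 0 < T%:R :> R by lra.
set q := delta / _ in tail tail'.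
have bq : b%:R * T%:R * q = delta / 8 by rewrite /q; field; rewrite !gt_eqF//; lra.
have h1 := ler_wpM2l (_ : 0 <= b%:R * T%:R) tail.
have h2 := ler_wpM2l (_ : 0 <= T%:R) tail'.
have q0 : 0 <= q by rewrite divr_ge0 ?mulr_ge0// ltW.
have h3 : T%:R * q <= b%:R * T%:R * q by rewrite ler_wpM2r// ler_peMl// ltW.
have := h1 (mulr_ge0 (ler0n _ _) (ler0n _ _)); have := h2 (ler0n _ _).
by case/andP: delta01; lra.
Qed.

End Numerics.

Theorem theorem8 (R : realType) :
  exists (C : R) (k : nat) (p : {poly R}),
  forall (eps delta : R), 0 < eps < 1 -> 0 < delta < 1 ->
  exists d : nat,
  forall n : nat, (0 < n)%N ->
  exists pr : params R, admissible pr /\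
  forall (tieW : seq (example n) -> sparity n -> sparity n -> bool)
         (tie0 : seq (rule n) -> seq (example n) -> nat -> nat -> bool),
  let algorithm := boost d (n%:R ^- d) pr tieW tie0 in
  (forall D : distr R n, uniform_marginal D ->
     1 - delta <=
       prob D (fun h => loss D h <= opt_halfspace D + eps) algorithm)
  /\ exists samples time : nat,
     [/\ runs_within algorithm samples time,
         samples%:R <= C * (1 + ln (n%:R / (eps * delta))) ^+ k
                         * (eps ^- 7 * n%:R `^ (60 * eps ^- 4))
       & time%:R <= (1 + ln delta^-1) ^+ k * (maxn n 2)%:R `^ p.[eps^-1]].
Proof.
pose c0 : R := 64 * 96 ^+ 2.
exists (12 * 96 ^+ 4 * (c0 + 43)), 1%N.
exists (85%:P * 'X^4 + (2 * (3840 * 96 ^+ 6 * (c0 + 44)) + 1)%:P).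
move=> eps delta eps01 delta01; have /andP[e0 e1] := eps01.
(* [d > 9 * eps^-4] says that [3 / sqrt d < eps^2], the tail bound with as many blocks as the
   degree. *)
pose d := (Num.trunc (9 * eps ^- 4)).+1.
have x1 : 1 <= eps ^- 4 := quartic_ge1 eps01.
have x0 : 0 <= 9 * eps ^- 4 by lra.
have /andP[t1 t2] := Num.Theory.truncn_itv x0.
have d_le : d%:R <= 10 * eps ^- 4 by rewrite /d -natr1; lra.
have d_gt : 9 * eps ^- 4 < d%:R by [].
have d2 : (1 < d <= d)%N by rewrite leqnn andbT -(ltr_nat R); lra.
have d_eps : 3 <= eps ^+ 2 * Num.sqrt d%:R.
  have h : Num.sqrt ((3 / eps ^+ 2) ^+ 2) <= Num.sqrt d%:R :> R.
    rewrite ler_wsqrtr//; apply/ltW; apply: le_lt_trans d_gt.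
    by rewrite le_eqVlt; apply/orP; left; apply/eqP; field; exact: lt0r_neq0.
  have E0 : 0 < eps ^+ 2 by rewrite exprn_gt0.
  move: h; rewrite sqrtr_sqr ger0_norm; last by rewrite divr_ge0// ltW.
  by rewrite ler_pdivrMr// mulrC.
exists d => n n0.
pose T := round_count eps n d; pose S := sample_count eps delta n d.
pose gamma : R := n%:R ^- d.
exists (Params (gamma ^+ 2 * eps / 48) 1 (4 * (gamma * eps / 96)) T S S S).
have eta0 := step_size_gt0 d eps01 n0.
split; first by split => //=; rewrite ltr01 lexx.
move=> tieW tie0 algorithm; split=> [D uD|].
  apply: (boost_success eps01 n0 d2 d_eps uD) => //.
  - exact: round_count_drop.
  - exact: failure_le.
exists (T * S + S)%N, (boost_time n T S S S d); split.
- apply: (runs_to_within (I := fun=> True)); apply: runs_to_boost => //.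
  + exact: edge_bounds.
  + exact: step_size_le.
- exact: samples_le.
have E (a b z : R) : (a%:P * 'X^4 + b%:P).[z] = a * z ^+ 4 + b.
  by rewrite hornerD hornerM hornerXn !hornerC.
rewrite E exprVn; exact: time_le.
Qed.
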